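(* Let $n\in\mathbb{N}$, let $\lambda$ be a partition of $n$ and let $U,V\in\mathrm{SYT}(\lambda)$ be such that $Z_U=Z_V$. Then $$C(U)=C(V).$$ In particular, the row-wise and column-wise Novelli--Pak--Stoyanovskii algorithms have the same complexity; that is, if $U,V\in\mathrm{SYT}(\lambda)$ are the standard Young tableaux defining the linear column-wise and the linear row-wise order on $\lambda$ respectively, then $C(U)=C(V)$.
   Context: A partition $\lambda=(\lambda_1\ge\lambda_2\ge\dots)$ of $n$ is identified with its Young diagram $\{(i,j): i\ge 1,\ 1\le j\le\lambda_i\}$ (English convention: row $i$, column $j$). A tableau of shape $\lambda$ is a bijection $T:\lambda\to\{1,\dots,n\}$; $\mathrm{T}(\lambda)$ is the set of all tableaux. $\mathrm{SYT}(\lambda)\subseteq \mathrm{T}(\lambda)$ is the set of standard Young tableaux, i.e. tableaux increasing along rows from left to right and along columns from top to bottom. For a cell $x=(i,j)\in\lambda$ put $N_\lambda^+(x)=\{(i+1,j),(i,j+1)\}\cap\lambda$. Novelli--Pak--Stoyanovskii algorithm corresponding to $U\in\mathrm{SYT}(\lambda)$: order the cells by $x\prec_U y :\Leftrightarrow U(x)<U(y)$. Given $T\in\mathrm{T}(\lambda)$ set $T_0=T$. If $T_s$ is not a standard Young tableau, let $x$ be the $\prec_U$-maximal cell with $N_\lambda^+(x)\neq\emptyset$ and $T_s(x)>\min\{T_s(y):y\in N_\lambda^+(x)\}$, and let $T_{s+1}$ be obtained from $T_s$ by exchanging the entry $T_s(x)$ with the entry $\min\{T_s(y):y\in N_\lambda^+(x)\}$.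 The process stops at the first tableau $T_r$ which is standard; write $r_U(T)=r$ for the number of steps and $\varphi_U(T)=T_r$. Complexity: $C(U)=\frac{1}{n!}\sum_{T\in\mathrm{T}(\lambda)}r_U(T)$. Distribution vector: for $W\in\mathrm{SYT}(\lambda)$ let $z_U(W)=|\{T\in\mathrm{T}(\lambda):\varphi_U(T)=W\}|$, and $Z_U=(z_U(W))_{W\in\mathrm{SYT}(\lambda)}$. The linear column-wise order is the order $\prec_U$ for the unique $U\in\mathrm{SYT}(\lambda)$ with $U(i+1,j)=U(i,j)+1$ whenever $(i,j),(i+1,j)\in\lambda$; the linear row-wise order is the order $\prec_U$ for the unique $U\in\mathrm{SYT}(\lambda)$ with $U(i,j+1)=U(i,j)+1$ whenever $(i,j),(i,j+1)\in\lambda$. The column-wise (row-wise) Novelli--Pak--Stoyanovskii algorithm is the algorithm corresponding to the respective $U$. *)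

(* Defs.v *)
From HB Require Import structures.
From mathcomp Require Import all_boot all_order all_fingroup all_algebra.
From mathcomp Require Import zify.

Set Implicit Arguments.
Unset Strict Implicit.
Unset Printing Implicit Defensive.

(* Rows, columns and entries are numbered from 0: the cell (i, j) and the     *)
(* entry k of the usual convention are (i - 1, j - 1) and k - 1 here.         *)

Record integer_partition (n : nat) := IntegerPartition {
  parts :> seq nat;
  partsP : [&& sorted geq parts, 0 \notin parts & sumn parts == n] }.

Section NPS.

Variables (n : nat) (lam : integer_partition n).

Definition cell : Type := {i : 'I_(size lam) & 'I_(nth 0 lam i)}.
HB.instance Definition _ := Finite.on cell.

Definition row_of (x : cell) : nat := tag x.
Definition col_of (x : cell) : nat := tagged x.

Definition below (x y : cell) : bool := (row_of y == (row_of x).+1) && (col_of y == col_of x).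
Definition right_of (x y : cell) : bool := (row_of y == row_of x) && (col_of y == (col_of x).+1).

Definition nplus (x : cell) : {set cell} := [set y | below x y || right_of x y].

Definition bijb (T : {ffun cell -> 'I_n}) : bool :=
  injectiveb T && [forall k, exists x, T x == k].

Record tableau := Tableau { entries :> {ffun cell -> 'I_n}; entries_bij : bijb entries }.
HB.instance Definition _ := [isSub for entries].
HB.instance Definition _ := [Finite of tableau by <:].

Definition standard (T : tableau) : bool :=
  [forall x, forall y,
     ((row_of x == row_of y) && (col_of x < col_of y) ==> (T x < T y)) &&
     ((col_of x == col_of y) && (row_of x < row_of y) ==> (T x < T y))].

Record syt := Syt { syt_tableau :> tableau; syt_standard : standard syt_tableau }.
HB.instance Definition _ := [isSub for syt_tableau].
HB.instance Definition _ := [Finite of syt by <:].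

(* The cell of nplus x holding the smallest entry; None iff nplus x is empty. *)
Definition min_nbr (T : tableau) (x : cell) : option cell :=
  [pick y in nplus x | [forall z in nplus x, T y <= T z]].

Definition unstable (T : tableau) (x : cell) : bool :=
  if min_nbr T x is Some y then T y < T x else false.

Definition pivot (U : syt) (T : tableau) : option cell :=
  [pick x | unstable T x & [forall z, unstable T z ==> (U z <= U x)]].

Lemma exchange_bij (T : tableau) (x y : cell) : bijb [ffun z => T (tperm x y z)].
Proof.
have /andP[/injectiveP injT /forallP surjT] := entries_bij T.
apply/andP; split.
  by apply/injectiveP => a b; rewrite !ffunE => /injT /perm_inj.
apply/forallP => k; have /existsP[z /eqP Tz] := surjT k.
by apply/existsP; exists (tperm x y z); rewrite ffunE tpermK Tz.
Qed.

Definition exchange (T : tableau) (x y : cell) : tableau :=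
  Tableau (exchange_bij T x y).

Definition nps_step (U : syt) (T : tableau) : tableau :=
  if pivot U T is Some x then
    if min_nbr T x is Some y then exchange T x y else T
  else T.

Lemma cell_eq (x y : cell) : row_of x = row_of y -> col_of x = col_of y -> x = y.
Proof.
case: x y => [i a] [j b]; rewrite /row_of /col_of /= => /val_inj eij.
by move: a; rewrite eij => a /val_inj ->.
Qed.

Lemma cell_ex (i j : nat) : j < nth 0 lam i -> exists x : cell, row_of x = i /\ col_of x = j.
Proof.
move=> lt_j.
have lt_i : i < size lam by rewrite ltnNge; apply/negP => le; move: lt_j; rewrite nth_default.
by exists (Tagged (fun i : 'I_(size lam) => 'I_(nth 0 lam i))
  (Ordinal lt_j : 'I_(nth 0 lam (Ordinal lt_i)))).
Qed.

Lemma cell_lt (x : cell) : col_of x < nth 0 lam (row_of x).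
Proof. by case: x => i a; apply: ltn_ord. Qed.

Lemma nth_lam_leq (i j : nat) : i <= j -> nth 0 lam j <= nth 0 lam i.
Proof.
move=> le_ij; case: (ltnP j (size lam)) => [lt_j|le_j]; last by rewrite (nth_default 0 le_j).
have /and3P[srt _ _] := partsP lam.
have geT : transitive geq by move=> a b c /= ba cb; apply: leq_trans ba.
apply: (sorted_leq_nth geT _ 0 srt) => //; first exact: leqnn.
by rewrite inE (leq_ltn_trans le_ij).
Qed.

Lemma tableau_inj (T : tableau) : injective T.
Proof. by have /andP[/injectiveP] := entries_bij T. Qed.

Lemma min_nbrP (T : tableau) (x y : cell) : y \in nplus x ->
  exists2 z, min_nbr T x = Some z & T z <= T y.
Proof.
move=> xy; rewrite /min_nbr; case: pickP => [z /andP[_ /forall_inP zP]|none].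
  by exists z => //; apply: zP.
case: (arg_minnP (fun z => nat_of_ord (T z)) xy) => z xz zP.
by have /andP[] := none z; split=> //; apply/forall_inP.
Qed.

Lemma min_nbr_in (T : tableau) (x y : cell) : min_nbr T x = Some y -> y \in nplus x.
Proof. by rewrite /min_nbr; case: pickP => // z /andP[xz _] [<-]. Qed.

Lemma nonstandard_unstable (T : tableau) : ~~ standard T -> exists x, unstable T x.
Proof.
move=> ns; apply/existsP; apply: contraNT ns => /existsP stab.
have adj x y : y \in nplus x -> T x < T y.
  move=> xy; have [z xz zy] := min_nbrP T xy.
  rewrite ltn_neqAle; apply/andP; split.
    apply/eqP => /val_inj /tableau_inj exy.
    by move: xy; rewrite inE /below /right_of exy; lia.
  apply: leq_trans zy; rewrite leqNgt; apply/negP => zx.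
  by apply: stab; exists x; rewrite /unstable xz.
have rows d : forall x y : cell, row_of y = row_of x -> col_of y = col_of x + d.+1 -> T x < T y.
  elim: d => [|d IHd] x y exy cxy.
    by apply: adj; rewrite inE /below /right_of; lia.
  have [|z [rz cz]] := @cell_ex (row_of x) (col_of x + d.+1).
    by rewrite -exy; apply: leq_ltn_trans (cell_lt y); lia.
  apply: ltn_trans (IHd x z rz cz) _; apply: adj.
  by rewrite inE /below /right_of; lia.
have cols d : forall x y : cell, col_of y = col_of x -> row_of y = row_of x + d.+1 -> T x < T y.
  elim: d => [|d IHd] x y exy cxy.
    by apply: adj; rewrite inE /below /right_of; lia.
  have [|z [rz cz]] := @cell_ex (row_of x + d.+1) (col_of x).
    by rewrite -exy; apply: leq_trans (cell_lt y) (nth_lam_leq _); lia.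
  apply: ltn_trans (IHd x z cz rz) _; apply: adj.
  by rewrite inE /below /right_of; lia.
apply/forallP => x; apply/forallP => y; apply/andP; split; apply/implyP => /andP[/eqP e lt].
  by apply: (rows (col_of y - col_of x).-1); lia.
by apply: (cols (row_of y - row_of x).-1); lia.
Qed.

Definition weight (T : tableau) : nat := \sum_(x : cell) (row_of x + col_of x) * T x.

Lemma weight_step (U : syt) (T : tableau) :
  ~~ standard T -> weight T < weight (nps_step U T).
Proof.
move=> /nonstandard_unstable[x0 ux0]; rewrite /nps_step /pivot.
case: pickP => [x /andP[ux _]|none]; last first.
  case: (arg_maxnP (fun z => nat_of_ord (U z)) ux0) => z uz zP.
  by have := none z; rewrite uz => /negP[]; apply/forall_inP.
move: ux; rewrite /unstable; case exy: min_nbr => [y|//] lt.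
have := min_nbr_in exy; rewrite inE => adj.
have nyx : y != x.
  by apply/eqP => e; move: adj; rewrite e /below /right_of; lia.
rewrite /weight (bigD1 x) // (bigD1 y) //= [ltnRHS](bigD1 x) // (bigD1 y) //=.
rewrite !ffunE tpermL tpermR.
under [in ltnRHS]eq_bigr => z /andP[zx zy] do
  rewrite ffunE tpermD 1?eq_sym //.
rewrite !addnA ltn_add2r.
have -> : row_of y + col_of y = (row_of x + col_of x).+1.
  by move: adj; rewrite /below /right_of; lia.
nia.
Qed.

Lemma nps_terminates (U : syt) (T : tableau) :
  exists s, standard (iter s (nps_step U) T).
Proof.
pose B := \sum_(x : cell) (row_of x + col_of x) * n.
have leB S : weight S <= B.
  by apply: leq_sum => x _; rewrite leq_mul2l (ltnW (ltn_ord _)) orbT.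
elim: {T}(B - weight T) {-2}T (leqnn (B - weight T)) => [|m IHm] T leT.
  exists 0; apply/negPn/negP => /(weight_step U).
  by have := leB (nps_step U T); move: leT => /=; lia.
have [sT|nsT] := boolP (standard T); first by exists 0.
have [|s sS] := IHm (nps_step U T).
  by have := weight_step U nsT; have := leB (nps_step U T); lia.
by exists s.+1; rewrite iterSr.
Qed.

Definition nps_count (U : syt) (T : tableau) : nat := ex_minn (nps_terminates U T).

Definition nps_result (U : syt) (T : tableau) : tableau :=
  iter (nps_count U T) (nps_step U) T.

Definition complexity (U : syt) : rat :=
  ((\sum_(T : tableau) nps_count U T)%N%:R / n`!%:R)%R.

Definition distribution (U : syt) : {ffun syt -> nat} :=
  [ffun W : syt => #|[set T : tableau | nps_result U T == W]|].

Definition column_wise (U : syt) : Prop :=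
  forall x y : cell, below x y -> U y = (U x).+1 :> nat.

Definition row_wise (U : syt) : Prop :=
  forall x y : cell, right_of x y -> U y = (U x).+1 :> nat.

End NPS.

(* Main.v *)
Require Import Defs.
From mathcomp Require Import all_boot all_order all_fingroup all_algebra.
From mathcomp Require Import zify ring.

(* The algorithm runs in rounds: in the round of a cell x the entry of x drops
   through the cells after x, which are sorted already.

   Complexity.  Fix a round, a position in that round and a small entry b.  Swapping
   m and m + 1 in the initial tableau shows that equally many tableaux exchange b
   with m there, for each m > b.  Hence, for H(m) = 1/n + 1/(n-1) + ... + 1/(n-m)
   with entries counted from 0, the increase H(m) - H(b) of the potential
   sum_x (row x + col x) H(T x) is on average 1 per exchange.  The total number of
   exchanges is thus the total potential of the outputs minus that of the inputs,
   and the former is determined by the distribution vector.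

   Uniformity.  For the column-wise order, a round is inverted by a backward slide
   from the final cell y of the dropping entry, and y is possible iff this slide ends
   in x.  Let x = (i, j).  By descending induction on x, the number of initial
   tableaux leading to T after the round of x is a constant times the product over
   the rows h >= i of column j of leg(h, j) + #{cells of row h, not left of column j,
   whose backward slide in T ends in x}.  At the top of a column all slides end in x,
   so this is constant.  The row-wise case is the transposed one. *)

Set Implicit Arguments.
Unset Strict Implicit.
Unset Printing Implicit Defensive.
Import GRing.Theory Num.Theory.

(** * Iterates and counting backward slides *)

Lemma iter_fixed (X : Type) (f : X -> X) (s : X) (m d : nat) :
  f (iter m f s) = iter m f s -> m <= d -> iter d f s = iter m f s.
Proof.
move=> fs le_md; rewrite -(subnK le_md) iterD.
by elim: (d - m) => //= q ->.
Qed.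

(** The rank rises at each proper step of [f] and stays below [N], so [N] iterations end in a fixed
    point. Since [g] undoes proper steps and fixes the start, [N] iterations of [g] return to it,
    however many of the steps were proper. *)
Lemma iter_partial_inverse (X : eqType) (I : X -> Prop) (f g : X -> X)
    (rk : X -> nat) (N : nat) :
  (forall s, I s -> f s != s -> [/\ I (f s), g (f s) = s & rk (f s) = (rk s).+1]) ->
  (forall s, rk s < N) ->
  forall s, I s -> g s = s ->
  [/\ I (iter N f s), f (iter N f s) = iter N f s & iter N g (iter N f s) = s].
Proof.
move=> fI rkN s Is gs.
have [m le_mN fm] : exists2 m, m <= N & f (iter m f s) = iter m f s.
  case: (pickP (fun m : 'I_N.+1 => f (iter m f s) == iter m f s)) => [m /eqP fm|nofix].
    by exists m => //; rewrite -ltnS.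
  suff E m : m <= N.+1 -> I (iter m f s) /\ rk (iter m f s) = rk s + m.
    by have [_ rkE] := E N.+1 (leqnn _); have := rkN (iter N.+1 f s); rewrite rkE; lia.
  elim: m => [|m IHm] lt_m; first by rewrite addn0.
  have [Im rkm] := IHm (ltnW lt_m).
  have [||IS _ rkS] := fI (iter m f s) => //.
    by have /= -> := nofix (Ordinal lt_m).
  by rewrite iterS rkS rkm addnS.
have back q : I (iter q f s) /\ exists2 p, p <= q & iter p g (iter q f s) = s.
  elim: q => [|q [Iq [p le_pq gp]]]; first by split=> //; exists 0.
  rewrite iterS; have [fq|/(fI _ Iq)[IS gf _]] := eqVneq (f (iter q f s)) (iter q f s).
    by rewrite fq; split=> //; exists p => //; apply: leqW.
  by split=> //; exists p.+1; rewrite ?ltnS // iterSr gf.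
have [IN [p le_pN gp]] := back N.
split=> //; first by rewrite (iter_fixed fm le_mN).
have -> : iter N g (iter N f s) = iter (N - p) g (iter p g (iter N f s)).
  by rewrite -iterD subnK.
by rewrite gp; elim: (N - p) => //= q ->.
Qed.

(** * A weighted count of the cells from which backward slides start *)

Section EntrySums.

Variables (e : nat -> nat -> nat) (len : nat -> nat) (l : nat).
Hypothesis e_le : forall h c, e h c <= c.
Hypothesis e_mono : forall h c c', c <= c' -> e h c <= e h c'.
Hypothesis len_mono : forall h h', h <= h' -> len h' <= len h.

(* With [e := exit_col V], this is the column in which the backward slide from
   [(h, c)] enters row [h - d]. *)
Fixpoint entry (d h c : nat) : nat := if d is d'.+1 then entry d' h.-1 (e h c) else c.

Lemma entry_le d h c : entry d h c <= c.
Proof. by elim: d h c => //= d IHd h c; apply: leq_trans (IHd _ _) (e_le _ _). Qed.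

Lemma entryS d h c : entry d.+1 h c = e (h - d) (entry d h c).
Proof.
elim: d h c => [|d IHd] h c; first by rewrite subn0.
by rewrite -[LHS]/(entry d.+1 h.-1 (e h c)) IHd /=; congr e; lia.
Qed.

(* Number of admissible fibre choices in the rows other than [a] that make [(a, c)]
   the cell from which the backward slide starts. *)
Definition entry_weight (g a c : nat) : nat :=
  (\prod_(g <= h < a) (l - h.+1 + entry (a - h) a c)) *
  \prod_(a.+1 <= h < l) (l - h.+1 + \sum_(c' < len h) (entry (h - a) h c' < c.+1)).

Lemma sum_ltn_ltn (tau u m : nat) : u < m ->
  \sum_(c < m) (c < tau) * (u < c.+1) = (u < tau) * (minn tau m - u).
Proof.
move=> lt_um; elim: m lt_um => // m IHm; rewrite ltnS leq_eqVlt => /orP[/eqP ->|lt_um].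
  rewrite big_ord_recr /= ltnSn big1 => [|c _]; first by case: ltnP; lia.
  by have := ltn_ord c; lia.
by rewrite big_ord_recr /= IHm //; lia.
Qed.

Lemma down_count (P : pred nat) m :
  (forall c c', c <= c' -> P c' -> P c) ->
  exists2 tau, tau <= m & forall c, c < m -> P c = (c < tau).
Proof.
move=> Pdown; elim: m => [|m [tau le_m tauP]]; first by exists 0.
have [Pm|nPm] := boolP (P m).
  by exists m.+1 => // c; rewrite ltnS => le_cm; rewrite (Pdown c m).
exists tau; first by apply: leqW.
move=> c; rewrite ltnS leq_eqVlt => /orP[/eqP ->|/tauP //].
by rewrite (negPf nPm); lia.
Qed.

Lemma sum_ltn tau m : tau <= m -> \sum_(c < m) (c < tau) = tau.
Proof.
elim: m => [|m IHm]; first by rewrite leqn0 big_ord0 => /eqP.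
rewrite leq_eqVlt => /orP[/eqP ->|lt_tau].
  rewrite (eq_bigr (fun _ => 1)) ?sum1_card ?card_ord // => c _.
  by rewrite ltn_ord.
by rewrite big_ord_recr /= IHm //; lia.
Qed.

(** Induction on the number of rows. The columns of row [g] with [e g c < t] are those below some
    [tau]. The weight of a start [(g, c)] is a product over the lower rows, which the induction
    hypothesis turns into a sum over starts [(a, c')] there. If the slide from [(a, c')] enters row
    [g] in column [u < tau], this yields [tau - u] extra copies of its weight, which complete its
    own factor [l - g.+1 + u] to [l - g.+1 + tau], the factor of row [g] on the right. *)
Lemma sum_entry_weight g t : g < l ->
  \sum_(g <= a < l) \sum_(c < len a) (entry (a - g).+1 a c < t) * entry_weight g a c =
  \prod_(g <= h < l) (l - h.+1 + \sum_(c < len h) (entry (h - g).+1 h c < t)).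
Proof.
move=> lt_gl; move: {2}(l - g.+1) (erefl (l - g.+1)) => q.
elim: q g t lt_gl => [|q IHq] g t lt_gl eq_q.
  have -> : l = g.+1 by lia.
  rewrite !big_nat1 subnn subnn add0n; apply: eq_bigr => c _.
  by rewrite /entry_weight big_geq ?big_geq //; lia.
have [|tau le_tau tauP] := @down_count (fun c => e g c < t) (len g).
  by move=> c c' le_c; apply: leq_ltn_trans; apply: e_mono.
rewrite big_ltn // [RHS]big_ltn //.
rewrite subnn.
have -> : \sum_(c < len g) (entry 1 g c < t) = tau.
  by rewrite -[RHS](sum_ltn le_tau); apply: eq_bigr => c _; rewrite /= tauP.
have entry_tau a c : g < a -> c < len a -> (entry (a - g).+1 a c < t) = (entry (a - g) a c < tau).
  move=> lt_ga lt_c; rewrite entryS.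
  have -> : a - (a - g) = g by lia.
  apply: tauP; apply: leq_ltn_trans (entry_le _ _ _) _.
  by apply: leq_trans lt_c (len_mono (ltnW lt_ga)).
have tail s : \prod_(g.+1 <= h < l) (l - h.+1 + \sum_(c < len h) (entry (h - g) h c < s)) =
    \sum_(g.+1 <= a < l) \sum_(c < len a) (entry (a - g) a c < s) * entry_weight g.+1 a c.
  rewrite big_nat_cond [RHS]big_nat_cond.
  rewrite (eq_bigr (fun h => l - h.+1 + \sum_(c < len h) (entry (h - g.+1).+1 h c < s))); last first.
    by move=> h /andP[/andP[lt_gh _] _]; have -> : (h - g.+1).+1 = h - g by lia.
  rewrite -big_nat_cond -IHq; [|lia|lia].
  rewrite big_nat_cond; apply: eq_bigr => h /andP[/andP[lt_gh _] _].
  by apply: eq_bigr => c _; have -> : (h - g.+1).+1 = h - g by lia.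
have -> : \prod_(g.+1 <= h < l) (l - h.+1 + \sum_(c < len h) (entry (h - g).+1 h c < t)) =
    \prod_(g.+1 <= h < l) (l - h.+1 + \sum_(c < len h) (entry (h - g) h c < tau)).
  apply: eq_big_nat => h /andP[lt_gh _]; congr (_ + _).
  by apply: eq_bigr => c _; rewrite entry_tau.
have -> : \sum_(c < len g) (entry 1 g c < t) * entry_weight g g c =
    \sum_(c < len g) \sum_(g.+1 <= a < l) \sum_(c' < len a)
      ((c < tau) * (entry (a - g) a c' < c.+1)) * entry_weight g.+1 a c'.
  apply: eq_bigr => c _; rewrite /= tauP // /entry_weight big_geq // mul1n tail.
  rewrite big_distrr /=; apply: eq_bigr => a _.
  by rewrite big_distrr /=; apply: eq_bigr => c' _; rewrite mulnA.
rewrite exchange_big /= tail -big_split big_distrr /=; apply: eq_big_nat => a /andP[lt_ga lt_al].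
rewrite exchange_big /= -big_split big_distrr /=; apply: eq_bigr => c' _.
rewrite -big_distrl /= sum_ltn_ltn; last first.
  apply: leq_ltn_trans (entry_le _ _ _) _; apply: leq_trans (ltn_ord c') _.
  exact/len_mono/ltnW.
rewrite entry_tau // (minn_idPl le_tau).
have -> : entry_weight g a c' = (l - g.+1 + entry (a - g) a c') * entry_weight g.+1 a c'.
  by rewrite /entry_weight [in LHS]big_ltn // -mulnA.
rewrite mulnA -mulnDl mulnA; congr (_ * _).
by case: ltnP => ? /=; lia.
Qed.

End EntrySums.

(** * The effect of a backward slide on the other slides *)

Definition goes_up (V : nat -> nat -> nat) (h c : nat) : bool :=
  (c == 0) || (0 < h) && (V h c.-1 < V h.-1 c).

(* Read [V h c] as the entry in row [h], column [c].  The backward slide always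
   moves to the larger of the upper and left neighbours: [exit_col V h c] is the
   column in which it leaves row [h] when started from [(h, c)], column [0] being
   left upwards only. *)
Fixpoint exit_col (V : nat -> nat -> nat) (h c : nat) : nat :=
  if goes_up V h c then c else if c is c'.+1 then exit_col V h c' else 0.

Section ExitColumn.

Variable V : nat -> nat -> nat.

Lemma exit_col_le h c : exit_col V h c <= c.
Proof.
elim: c => [|c IHc] //=.
by case: ifP => // _; apply: leqW.
Qed.

Lemma exit_col_up h c : goes_up V h (exit_col V h c).
Proof. by elim: c => [|c IHc] //=; case: ifP. Qed.

Lemma exit_col_max h c c' : c' <= c -> goes_up V h c' -> c' <= exit_col V h c.
Proof.
elim: c => [|c IHc]; first by rewrite leqn0 => /eqP ->.
rewrite leq_eqVlt => /orP[/eqP -> /= -> //|lt_c up_c'].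
by rewrite /=; case: ifP => _; [apply: ltnW | apply: IHc].
Qed.

Lemma exit_col_mono h c c' : c <= c' -> exit_col V h c <= exit_col V h c'.
Proof.
move=> le_c; apply: exit_col_max (exit_col_up h c).
exact: leq_trans (exit_col_le _ _) le_c.
Qed.

Lemma exit_col0 c : exit_col V 0 c = 0.
Proof. by elim: c. Qed.

End ExitColumn.

Lemma eq_exit_col V V' h c :
  (forall c', c' <= c -> goes_up V h c' = goes_up V' h c') ->
  exit_col V h c = exit_col V' h c.
Proof.
elim: c => [|c IHc] eqV //=; rewrite eqV // IHc // => c' le_c'.
by apply: eqV; apply: leqW.
Qed.

(** A slide starting in the initial segment [B] cannot go up at a column outside [B'], so it exits
    in [B']. One starting beyond [B] can go up at the first column after [B], so it exits there or
    further right, outside [B']. *)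
Lemma exit_col_down (V : nat -> nat -> nat) (B B' : pred nat) h c :
  B 0 ->
  (forall c1 c2, c1 <= c2 -> B c2 -> B c1) -> (forall c1 c2, c1 <= c2 -> B' c2 -> B' c1) ->
  (forall c0, c0 <= c -> B c0 -> ~~ B' c0 -> ~~ goes_up V h c0) ->
  (forall c0, c0 < c -> B c0 -> ~~ B c0.+1 -> goes_up V h c0.+1 && ~~ B' c0.+1) ->
  B' (exit_col V h c) = B c.
Proof.
move=> B0 Bdown B'down stay leave; have [Bc|nBc] := boolP (B c).
  apply/negPn/negP => nB'; have le_e := exit_col_le V h c.
  by have /negP[] := stay _ le_e (Bdown _ _ le_e Bc) nB'; apply: exit_col_up.
have [c0 [lt_c0 Bc0 nBc0]] : exists c0, [/\ c0 < c, B c0 & ~~ B c0.+1].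
  elim: c nBc {stay leave} => [|c IHc] nBc; first by rewrite B0 in nBc.
  have [Bc|/IHc[c0 [? ? ?]]] := boolP (B c); first by exists c.
  by exists c0; split=> //; apply: leqW.
have /andP[up nB'] := leave c0 lt_c0 Bc0 nBc0.
by apply/negbTE; apply: contra nB'; apply: B'down; apply: exit_col_max.
Qed.

(** * Backward slides after the entries along one slide have been shifted *)

Section ShiftedPath.

Variables (V V' : nat -> nat -> nat) (len : nat -> nat) (i a b0 : nat).
Hypothesis le_ia : i <= a.
Hypothesis len_mono : forall h h', h <= h' -> len h' <= len h.
Hypothesis V_row : forall h c, i <= h -> c.+1 < len h -> V h c < V h c.+1.
Hypothesis V_col : forall h c, i <= h -> c < len h.+1 -> V h c < V h.+1 c.

(** In row [h] the slide from [(a, b0)] occupies the columns [beta h] to [beta h.+1]: it enters at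
    the right end and leaves upwards at the left end, whence [beta a.+1] is [b0]. *)
Definition path_col (h : nat) : nat := entry (exit_col V) (a.+1 - h) a b0.
Local Notation beta := path_col.

Hypothesis beta_i : beta i = 0.

Definition on_path (h c : nat) : bool := (i <= h <= a) && (beta h <= c <= beta h.+1).

Hypothesis V'_off : forall h c, i <= h -> c < len h -> ~~ on_path h c -> V' h c = V h c.
Hypothesis V'_left : forall h c, i <= h <= a -> beta h < c <= beta h.+1 -> V' h c = V h c.-1.
Hypothesis V'_up : forall h, i < h <= a -> V' h (beta h) = V h.-1 (beta h).

Lemma path_col_last : beta a.+1 = b0.
Proof. by rewrite /path_col subnn. Qed.

Lemma path_colE h : h <= a -> beta h = exit_col V h (beta h.+1).
Proof.
move=> le_h; rewrite /path_col subSS subSn // entryS //.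
by rewrite subKn.
Qed.

Lemma path_col_mono h : h <= a -> beta h <= beta h.+1.
Proof. by move=> /path_colE ->; apply: exit_col_le. Qed.

(** A region whose boundary the slides in [V'] do not cross. Up to row [a] it ends where the path
    leaves the row; further down it consists of the cells whose slide in [V] enters row [a] no
    further right than [b0]. *)
Definition below_path (h c : nat) : bool :=
  if h <= a then c <= beta h else entry (exit_col V) (h - a) h c <= b0.

Lemma entry_exit_mono d h c c' :
  c <= c' -> entry (exit_col V) d h c <= entry (exit_col V) d h c'.
Proof. by elim: d h c c' => //= d IHd h c c' le_c; apply/IHd/exit_col_mono. Qed.

Lemma below_path0 h : below_path h 0.
Proof.
rewrite /below_path; case: ifP => // _.
by apply: leq_trans (leq0n _); apply: entry_le => *; apply: exit_col_le.
Qed.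

Lemma below_path_down h c1 c2 : c1 <= c2 -> below_path h c2 -> below_path h c1.
Proof.
rewrite /below_path => le_c; case: ifP => _; first exact: leq_trans.
exact/leq_trans/entry_exit_mono.
Qed.

(** Where the row above has been shifted, the upper neighbour came from the left and is smaller than
    the left neighbour by [V_col], so the slide stays in its row. Just right of the region, the left
    neighbour came down from the row above and is smaller than the upper one by [V_row], so the
    slide goes up. Row [a.+1] is itself unshifted and also inherits moves from [V]. *)
Lemma below_path_step h c : i < h -> c < len h ->
  below_path h.-1 (exit_col V' h c) = below_path h c.
Proof.
case: h => // h; rewrite ltnS => le_ih lt_c; rewrite [h.+1.-1]/=.
have bd := below_path_down.
have [lt_ah|le_ha] := ltnP a h.
  rewrite {2}/below_path leqNgt (leqW lt_ah) /= subSn ?(ltnW lt_ah) //=.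
  rewrite /below_path leqNgt lt_ah /=; congr (entry _ _ _ _ <= _).
  apply: eq_exit_col => c' le_c'; rewrite /goes_up.
  have [//|c'_gt0] := posnP c'; rewrite /=.
  rewrite [V' h.+1 _]V'_off; [|lia|lia|by rewrite /on_path; lia].
  rewrite V'_off //; last by rewrite /on_path; lia.
  by apply: leq_trans (len_mono (leqnSn h)); apply: leq_ltn_trans lt_c.
have lenS c0 : c0 < len h.+1 -> c0 < len h by move/leq_trans; apply; apply: len_mono.
apply: exit_col_down; [exact: below_path0|exact: bd|exact: bd| |].
- move=> c0 le_c0; rewrite {2}/below_path le_ha -ltnNge => B0 lt_b.
  have c0_gt0 : 0 < c0 by lia.
  rewrite /goes_up negb_or -lt0n c0_gt0 /= -leqNgt.
  have V1 : V h c0.-1 < V h.+1 c0.-1 by apply: V_col => //; lia.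
  have [eq_ha|ne_ha] := eqVneq h a.
    subst h; rewrite [V' a.+1 _]V'_off; [|lia|lia|by rewrite /on_path; lia].
    have [le_b|lt_b0] := leqP c0 (beta a.+1).
      by rewrite V'_left; lia.
    rewrite V'_off //; [|by apply: lenS; lia|by rewrite /on_path; lia].
    move: B0; rewrite /below_path ltnn subSn // subnn /=.
    rewrite path_col_last in lt_b0 => le_e.
    have : ~~ goes_up V a.+1 c0.
      by apply: contraL le_e => up; rewrite -ltnNge; apply: leq_trans lt_b0 (exit_col_max _ up).
    by rewrite /goes_up negb_or -lt0n c0_gt0 /= -leqNgt.
  move: B0; rewrite /below_path ifT ?ltn_neqAle ?ne_ha // => B0.
  rewrite [V' h.+1 _]V'_off; [|lia|lia|by rewrite /on_path; lia].
  by rewrite V'_left; lia.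
- move=> c0 lt_c0 B0 nB1; rewrite /goes_up /=.
  have [eq_ha|ne_ha] := eqVneq h a.
    subst h; move: B0 nB1; rewrite /below_path ltnn leqnn subSn // subnn -ltnNge.
    rewrite -[entry _ 1 _ c0.+1]/(exit_col V a.+1 c0.+1) -[entry _ 1 _ c0]/(exit_col V a.+1 c0).
    move=> B0; rewrite [exit_col V a.+1 c0.+1]/=; case: ifP => [up lt_b|_]; last by lia.
    rewrite -path_col_last in lt_b B0; have := path_col_mono (leqnn a).
    move: up; rewrite /goes_up /= => up le_b.
    rewrite [V' a.+1 _]V'_off; [|lia|lia|by rewrite /on_path; lia].
    rewrite V'_off; [|lia|by apply: lenS; lia|by rewrite /on_path; lia].
    by rewrite up; lia.
  have lt_ha : h < a by rewrite ltn_neqAle ne_ha.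
  move: B0 nB1; rewrite /below_path lt_ha le_ha -!ltnNge => B0 B1.
  have <- : beta h.+1 = c0 by lia.
  rewrite V'_up; last by lia.
  have := path_col_mono (ltnW lt_ha).
  rewrite V'_off; [|lia|by apply: lenS; lia|by rewrite /on_path; lia] => le_b.
  by rewrite /= V_row ?lenS //; lia.
Qed.

Lemma below_pathE h c : i <= h -> c < len h ->
  (entry (exit_col V') (h - i) h c == 0) = below_path h c.
Proof.
move=> le_ih; have [d ->] : exists d, h = i + d by exists (h - i); lia.
rewrite addKn; elim: d c => [|d IHd] c lt_c.
  by rewrite addn0 /below_path le_ia beta_i leqn0.
rewrite -[entry _ d.+1 _ c]/(entry (exit_col V') d (i + d.+1).-1 (exit_col V' (i + d.+1) c)).
rewrite -below_path_step //; last by lia.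
rewrite addnS /= IHd // -addnS.
apply: leq_ltn_trans (exit_col_le _ _ _) _; apply: leq_trans lt_c _.
by apply: len_mono; lia.
Qed.

Lemma prod_below_path l : a < l -> b0 < len a ->
  \prod_(i.+1 <= h < l)
     (l - h.+1 + \sum_(c < len h) (entry (exit_col V') (h - i) h c == 0)) =
  entry_weight (exit_col V) len l i a b0.
Proof.
move=> lt_al lt_b0; rewrite /entry_weight (@big_cat_nat _ _ _ a.+1) //=.
congr (_ * _).
  (* Row [h] has [beta h + 1] columns in the region, so its factor is [l - h + beta h]. Shifting the
     row index by one makes this the factor of row [h.-1] in [entry_weight]. *)
  rewrite [LHS](_ : _ = \prod_(i.+1 <= h < a.+1) (l - h + beta h)).
    rewrite big_add1 /=; apply: eq_big_nat => h /andP[_ lt_ha].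
    by rewrite /path_col subSS.
  apply: eq_big_nat => h /andP[lt_ih]; rewrite ltnS => le_ha.
  rewrite (_ : \sum_(c < len h) _ = (beta h).+1); first by lia.
  have lt_bh : beta h < len h.
    apply: leq_ltn_trans (_ : b0 < _); last by apply: leq_trans lt_b0 _; apply: len_mono.
    by apply: entry_le => *; apply: exit_col_le.
  rewrite -[RHS](sum_ltn lt_bh); apply: eq_bigr => c _.
  by rewrite below_pathE ?(ltnW lt_ih) // /below_path le_ha ltnS.
apply: eq_big_nat => h /andP[lt_ah _]; congr (_ + _).
apply: eq_bigr => c _; rewrite below_pathE //; last by lia.
by rewrite /below_path leqNgt lt_ah ltnS.
Qed.

End ShiftedPath.

(** * Rounds of the algorithm *)

Section Rounds.

Variables (n : nat) (lam : integer_partition n) (U : syt lam).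

Implicit Types (S T : tableau lam) (x y z w p : cell lam) (k d : nat).

Definition rank x : nat := row_of x + col_of x.

Lemma rank_nplus z w : w \in nplus z -> rank w = (rank z).+1.
Proof. by rewrite /rank inE /below /right_of; lia. Qed.

Lemma nplus_neq z w : w \in nplus z -> w != z.
Proof. by move=> /rank_nplus rk; apply/eqP => e; rewrite e in rk; lia. Qed.

Lemma standard_nplus T z w : standard T -> w \in nplus z -> T z < T w.
Proof.
move=> /forallP/(_ z)/forallP/(_ w)/andP[/implyP rowz /implyP colz].
by rewrite inE => /orP[] /andP[/eqP e1 /eqP e2]; [apply: colz|apply: rowz]; rewrite e1 e2 eqxx ltnSn.
Qed.

Lemma syt_nplus z w : w \in nplus z -> U z < U w.
Proof. exact/standard_nplus/syt_standard. Qed.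

Lemma tableau_eq T x y : (T x == T y :> nat) = (x == y).
Proof. by rewrite (inj_eq val_inj) (inj_eq (@tableau_inj _ _ T)). Qed.

Lemma tableau_ext S T : (forall x, S x = T x :> nat) -> S = T.
Proof. by move=> eqST; apply/val_inj/ffunP => x; apply/val_inj/eqST. Qed.

Lemma tableau_surj T (m : nat) : m < n -> exists x, T x = m :> nat.
Proof.
move=> lt_m; have /andP[_ /forallP/(_ (Ordinal lt_m))/existsP[x /eqP Tx]] := entries_bij T.
by exists x; rewrite Tx.
Qed.

Lemma exchangeE T x y z : exchange T x y z = T (tperm x y z).
Proof. by rewrite /= ffunE. Qed.

Lemma exchangeL T x y : exchange T x y x = T y.
Proof. by rewrite exchangeE tpermL. Qed.

Lemma exchangeR T x y : exchange T x y y = T x.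
Proof. by rewrite exchangeE tpermR. Qed.

Lemma exchangeD T x y z : z != x -> z != y -> exchange T x y z = T z.
Proof. by move=> zx zy; rewrite exchangeE tpermD // eq_sym. Qed.

Lemma exchangeK T x y : exchange (exchange T x y) x y = T.
Proof. by apply: tableau_ext => z; rewrite !exchangeE tpermK. Qed.

Lemma min_nbr_le T x y z : min_nbr T x = Some y -> z \in nplus x -> T y <= T z.
Proof.
by rewrite /min_nbr; case: pickP => // w /andP[_ /forall_inP wP] [<-]; apply: wP.
Qed.

Lemma min_nbrE T x y :
  y \in nplus x -> (forall z, z \in nplus x -> T y <= T z) -> min_nbr T x = Some y.
Proof.
move=> xy yP; have [w xw wy] := min_nbrP T xy; rewrite xw; congr Some.
by apply/eqP; rewrite -(tableau_eq T) eqn_leq wy yP // (min_nbr_in xw).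
Qed.

(* A state [(T, p)] of a round: [p] is the current cell of the dropping entry. *)
Definition drop_step (s : tableau lam * cell lam) : tableau lam * cell lam :=
  if min_nbr s.1 s.2 is Some y then
    if s.1 y < s.1 s.2 then (exchange s.1 s.2 y, y) else s
  else s.

(** The bound [k <= U w] keeps backward slides among the cells whose rounds have taken place. *)
Definition max_pred k T z : option (cell lam) :=
  [pick w | [&& z \in nplus w, k <= U w &
    [forall v, (z \in nplus v) && (k <= U v) ==> (T v <= T w)]]].

Definition undrop_step k (s : tableau lam * cell lam) : tableau lam * cell lam :=
  if max_pred k s.1 s.2 is Some w then (exchange s.1 w s.2, w) else s.

Lemma max_predE k T z w :
  z \in nplus w -> k <= U w ->
  (forall v, z \in nplus v -> k <= U v -> T v <= T w) -> max_pred k T z = Some w.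
Proof.
move=> zw kw wP; rewrite /max_pred; case: pickP => [v /and3P[zv kv /forallP vP]|/(_ w)].
  congr Some; apply/eqP; rewrite -(tableau_eq T) eqn_leq wP //=.
  by have /implyP -> := vP w; rewrite // zw.
rewrite zw kw /= => /negP[]; apply/forallP => v; apply/implyP => /andP[]; exact: wP.
Qed.

Lemma max_predP k T z w : max_pred k T z = Some w ->
  [/\ z \in nplus w, k <= U w & forall v, z \in nplus v -> k <= U v -> T v <= T w].
Proof.
rewrite /max_pred; case: pickP => // v /and3P[zv kv /forallP vP] [<-]; split=> // u zu ku.
by have /implyP -> := vP u; rewrite // zu.
Qed.

Definition sorted_from k T : bool :=
  [forall z, forall w, (k <= U z) && (w \in nplus z) ==> (T z < T w)].

Lemma sorted_fromP k T :
  reflect (forall z w, k <= U z -> w \in nplus z -> T z < T w) (sorted_from k T).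
Proof.
apply: (iffP forallP) => [sT z w kz zw|sT z].
  by have /forallP/(_ w)/implyP -> := sT z; rewrite // kz.
by apply/forallP => w; apply/implyP => /andP[]; apply: sT.
Qed.

Lemma sorted_from0 T : sorted_from 0 T = standard T.
Proof.
apply/sorted_fromP/idP => [sT|sT z w _]; last exact: standard_nplus.
apply/negPn/negP => /nonstandard_unstable[x]; rewrite /unstable.
case xy: (min_nbr T x) => [y|//]; have := sT x y (leq0n _) (min_nbr_in xy).
by lia.
Qed.

(** Invariant of a round: the order may fail only between [s.2] and its successors. The last clause
    asks for order across [s.2], so that an exchange in either direction preserves the invariant. *)
Definition dropping k (s : tableau lam * cell lam) : Prop :=
  [/\ k <= U s.2,
      forall z w, z != s.2 -> k <= U z -> w \in nplus z -> s.1 z < s.1 w &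
      forall z w, k <= U z -> s.2 \in nplus z -> w \in nplus s.2 -> s.1 z < s.1 w].

Lemma drop_step_unstable s : (drop_step s != s) = unstable s.1 s.2.
Proof.
case: s => T p; rewrite /drop_step /unstable /=.
case py: (min_nbr T p) => [y|]; last by rewrite eqxx.
case: ifP => _; last by rewrite eqxx.
by apply/eqP => -[_ e]; have := nplus_neq (min_nbr_in py); rewrite e eqxx.
Qed.

Lemma drop_stepE T p y : min_nbr T p = Some y -> T y < T p ->
  drop_step (T, p) = (exchange T p y, y).
Proof. by rewrite /drop_step /= => -> /= ->. Qed.

Lemma undrop_stepE k T z w : max_pred k T z = Some w ->
  undrop_step k (T, z) = (exchange T w z, w).
Proof. by rewrite /undrop_step /= => ->. Qed.

(** The exchange moves the old entry of [y] to [p]. Every other predecessor of [y] holds a smaller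
    entry, so [max_pred] finds [p] again. *)
Lemma drop_stepP k s : dropping k s -> drop_step s != s ->
  [/\ dropping k (drop_step s), undrop_step k (drop_step s) = s &
      rank (drop_step s).2 = (rank s.2).+1].
Proof.
case: s => T p [/= kp s1 s2]; rewrite drop_step_unstable /unstable /=.
case py: (min_nbr T p) => [y|] // lt_yp; rewrite (drop_stepE py lt_yp) /=.
have nb := min_nbr_in py; have rky := rank_nplus nb; have yp := nplus_neq nb.
have ky : k <= U y by apply: leq_trans kp (ltnW (syt_nplus nb)).
move: (exchangeL T p y) (exchangeR T p y) (@exchangeD T p y) (exchangeK T p y).
move: (exchange T p y) => T' E1 E2 E3 EK.
split=> //.
- split=> //=.
  + move=> z w zy kz zw; have [ezp|zp] := eqVneq z p.
      subst z; rewrite E1; have [->|wy] := eqVneq w y; first by rewrite E2.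
      rewrite E3 ?(nplus_neq zw) //.
      have := min_nbr_le py zw; rewrite leq_eqVlt (tableau_eq T).
      by rewrite eq_sym (negPf wy).
    rewrite E3 //; have [ewp|wp] := eqVneq w p.
      by subst w; rewrite E1; apply: s2 nb.
    have [ewy|wy] := eqVneq w y; last by rewrite E3 //; apply: s1.
    by subst w; rewrite E2; apply: ltn_trans lt_yp; apply: s1.
  + move=> z w kz zy yw; have rkw := rank_nplus yw.
    have wp : w != p by apply/eqP => e; subst w; lia.
    have wy := nplus_neq yw; rewrite [T' w]E3 //.
    have yw' : T y < T w by apply: s1.
    have [->|zp] := eqVneq z p; first by rewrite E1.
    rewrite E3 //; last by have := nplus_neq zy; rewrite eq_sym.
    by apply: ltn_trans yw'; apply: s1.
- rewrite (@undrop_stepE _ _ _ p) ?EK //; apply: max_predE => // v vy kv.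
  have [->|vp] := eqVneq v p; first by rewrite leqnn.
  rewrite E1 E3 //; first exact/ltnW/s1.
  by have := nplus_neq vy; rewrite eq_sym.
Qed.

Lemma undrop_stepP k s : dropping k s -> undrop_step k s != s ->
  [/\ dropping k (undrop_step k s), drop_step (undrop_step k s) = s &
      rank s.2 = (rank (undrop_step k s).2).+1].
Proof.
case: s => T y [/= ky s1 s2]; rewrite /undrop_step /=.
case yp: (max_pred k T y) => [p|]; last by rewrite eqxx.
move=> _; have {yp}[nb kp pP] := max_predP yp.
have rky := rank_nplus nb; have yp := nplus_neq nb.
move: (exchangeL T p y) (exchangeR T p y) (@exchangeD T p y) (exchangeK T p y).
move: (exchange T p y) => T' E1 E2 E3 EK.
have lt_py : T p < T y by apply: s1; rewrite // eq_sym.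
have py w : w \in nplus p -> w != y -> T p < T w.
  by move=> pw wy; apply: s1; rewrite // eq_sym.
have yz z : y \in nplus z -> z != y by move=> /nplus_neq; rewrite eq_sym.
split=> //=.
- split=> //= z w; first last.
    move=> kz zp pw; have zy : z != y.
      by apply/eqP => e; subst z; have := rank_nplus zp; lia.
    have pz : z != p by have := nplus_neq zp; rewrite eq_sym.
    have lt_zp : T z < T p by apply: s1.
    rewrite E3 //; have [->|wy] := eqVneq w y; first by rewrite E2.
    rewrite E3 ?(nplus_neq pw) //; apply: ltn_trans lt_zp _.
    exact: py.
  move=> zp kz zw; have [ezy|zy] := eqVneq z y.
    subst z; have rkw := rank_nplus zw.
    rewrite E2 E3 ?(nplus_neq zw) //; first exact: s2 nb zw.
    by apply/eqP => e; subst w; lia.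
  rewrite E3 //; have [ewp|wp] := eqVneq w p.
    by subst w; rewrite E1; apply: ltn_trans lt_py; apply: s1.
  have [ewy|wy] := eqVneq w y; last by rewrite E3 //; apply: s1.
  subst w; rewrite E2; have := pP _ zw kz.
  by rewrite leq_eqVlt (tableau_eq T) (negPf zp).
- rewrite (@drop_stepE _ p y) ?EK //; last by rewrite E1 E2.
  apply: min_nbrE => // w pw; rewrite E2.
  have [->|wy] := eqVneq w y; first by rewrite E2.
  by rewrite E3 ?(nplus_neq pw) // ltnW // py.
Qed.

(** Each proper step changes the rank by one, so [depth] iterations complete any slide; surplus ones
    are idle. *)
Definition depth : nat := (\max_x rank x).+1.

Lemma rank_lt x : rank x < depth.
Proof. by rewrite ltnS; apply: leq_bigmax. Qed.

Definition drop_entry x T : tableau lam * cell lam := iter depth drop_step (T, x).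
Definition undrop k T y : tableau lam * cell lam := iter depth (undrop_step k) (T, y).

Lemma dropping_start k x T : U x = k :> nat -> sorted_from k.+1 T -> dropping k (T, x).
Proof.
move=> Ux /sorted_fromP sT; split=> /= [|z w zx kz zw|z w kz zx].
- by rewrite Ux.
- apply: sT => //; rewrite ltn_neqAle kz andbT -Ux eq_sym.
  by rewrite (tableau_eq U).
- by have := syt_nplus zx; lia.
Qed.

Lemma dropping_start_sorted k x T : U x = k :> nat -> dropping k (T, x) -> sorted_from k.+1 T.
Proof.
move=> Ux [/= _ s1 _]; apply/sorted_fromP => z w kz zw; apply: s1 => //; last exact: ltnW.
by apply/eqP => e; subst z; lia.
Qed.

Lemma dropping_stop k T y : k <= U y -> sorted_from k T -> dropping k (T, y).
Proof.
move=> ky /sorted_fromP sT; split=> //= z w; first by move=> _; apply: sT.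
by move=> kz zy yw; apply: ltn_trans (sT _ _ kz zy) (sT _ _ ky yw).
Qed.

Lemma drop_step_fixed k T y : k <= U y -> sorted_from k T -> drop_step (T, y) = (T, y).
Proof.
move=> ky /sorted_fromP sT; apply/eqP; rewrite -[_ == _]negbK drop_step_unstable /unstable /=.
case yz: min_nbr => [z|//]; rewrite -leqNgt; apply/ltnW/sT => //.
exact: min_nbr_in yz.
Qed.

Lemma dropping_fixed_sorted k s : dropping k s -> drop_step s = s -> sorted_from k s.1.
Proof.
case: s => T y [/= ky s1 s2] fix_y; apply/sorted_fromP => z w kz zw.
have [ezy|] := eqVneq z y; last by move=> zy; apply: s1.
subst z; have := drop_step_unstable (T, y); rewrite fix_y eqxx /unstable /=.
have [v yv vw] := min_nbrP T zw; rewrite yv => /esym/negbT; rewrite -leqNgt => yv'.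
rewrite ltn_neqAle (leq_trans yv' vw) andbT (tableau_eq T) eq_sym.
exact: nplus_neq.
Qed.

Lemma undrop_step_start k x T : U x = k :> nat -> undrop_step k (T, x) = (T, x).
Proof.
move=> Ux; rewrite /undrop_step /=; case E: max_pred => [w|//].
by have [/syt_nplus + kw _] := max_predP E; lia.
Qed.

Lemma dropP k x T : U x = k :> nat -> sorted_from k.+1 T ->
  [/\ sorted_from k (drop_entry x T).1, k <= U (drop_entry x T).2 &
      undrop k (drop_entry x T).1 (drop_entry x T).2 = (T, x)].
Proof.
move=> Ux sT.
have [dr fx bk] := iter_partial_inverse (@drop_stepP k) (fun s => rank_lt s.2)
  (dropping_start Ux sT) (undrop_step_start T Ux).
split; first exact: dropping_fixed_sorted dr fx.
  by have [] := dr.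
by rewrite /undrop /drop_entry -surjective_pairing.
Qed.

Lemma undropP k T y : k <= U y -> sorted_from k T ->
  [/\ dropping k (undrop k T y), undrop_step k (undrop k T y) = undrop k T y &
      iter depth drop_step (undrop k T y) = (T, y)].
Proof.
move=> ky sT.
(* Backward steps lower the rank, so its complement serves as the increasing quantity. *)
apply: (@iter_partial_inverse _ _ _ _ (fun s => depth - (rank s.2).+1)).
- move=> [S z] dr mv; have [dr' inv rk] := undrop_stepP dr mv; split=> //.
  by move: (rank_lt z) rk => /=; move: (undrop_step _ _).2; lia.
- by move=> [S z] /=; have := rank_lt z; lia.
- exact: dropping_stop.
- exact: drop_step_fixed ky sT.
Qed.

(** By [dropP] and [undropP], dropping and undropping are mutually inverse once the final cell [y]
    of the dropping entry is remembered. Hence the preimages of [T] correspond to the cells [y]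
    whose backward slide ends in [x]. *)
Lemma sum_drop_fibre k x T (F : tableau lam -> nat) : U x = k :> nat -> sorted_from k T ->
  \sum_(S | sorted_from k.+1 S && ((drop_entry x S).1 == T)) F S =
  \sum_(y | (k <= U y) && ((undrop k T y).2 == x)) F (undrop k T y).1.
Proof.
move=> Ux sT.
rewrite (reindex_onto (fun y => (undrop k T y).1) (fun S => (drop_entry x S).2)) /=.
  apply: eq_bigl => y; apply/idP/idP.
    move=> /andP[/andP[sS /eqP dS] /eqP dy].
    have [_ ky bk] := dropP Ux sS; rewrite dS dy in ky bk.
    by rewrite ky bk eqxx.
  move=> /andP[ky /eqP ux]; have [dr _ fw] := undropP ky sT.
  have eqs : undrop k T y = ((undrop k T y).1, x) by rewrite -ux -surjective_pairing.
  rewrite eqs in dr fw; rewrite (dropping_start_sorted Ux dr) /=.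
  by rewrite /drop_entry fw /= !eqxx.
by move=> S /andP[sS /eqP dS]; have [_ _] := dropP Ux sS; rewrite dS => ->.
Qed.

(** * The rounds together make up the algorithm *)

Definition cell_of k : option (cell lam) := [pick x | U x == k :> nat].

Lemma cell_ofE k x : U x = k :> nat -> cell_of k = Some x.
Proof.
move=> Ux; rewrite /cell_of; case: pickP => [y /eqP Uy|/(_ x)]; last by rewrite Ux eqxx.
by congr Some; apply/eqP; rewrite -(tableau_eq U) Uy Ux.
Qed.

Fixpoint rounds d T : tableau lam :=
  if d is d'.+1 then
    let S := rounds d' T in if cell_of (n - d) is Some x then (drop_entry x S).1 else S
  else T.

(** The tableau once the rounds of all cells with [U]-value at least [k] are finished. *)
Definition after k T : tableau lam := rounds (n - k) T.

Lemma after_n T : after n T = T.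
Proof. by rewrite /after subnn. Qed.

Lemma after_step k x T : U x = k :> nat -> after k T = (drop_entry x (after k.+1 T)).1.
Proof.
move=> Ux; have lt_kn : k < n by rewrite -Ux.
rewrite /after (_ : n - k = (n - k.+1).+1) /=; last by lia.
by rewrite (_ : n - (n - k.+1).+1 = k) ?(cell_ofE Ux) //; lia.
Qed.

Lemma round_ind (P : nat -> Prop) :
  P n -> (forall x, P (U x).+1 -> P (U x)) -> forall k, k <= n -> P k.
Proof.
move=> Pn PS k le_kn; rewrite -(subKn le_kn); move: (n - k) (leq_subr k n).
elim=> [|d IHd] le_dn; first by rewrite subn0.
have [|x Ux] := @tableau_surj U (n - d.+1); first by lia.
rewrite -Ux; apply: PS; rewrite Ux (_ : (n - d.+1).+1 = n - d); last by lia.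
exact/IHd/ltnW.
Qed.

Lemma after_sorted k T : k <= n -> sorted_from k (after k T).
Proof.
move: k; apply: round_ind => [|x sT].
  by apply/sorted_fromP => z w; have := ltn_ord (U z); lia.
by rewrite (after_step _ (erefl _)); have [] := dropP (erefl _) sT.
Qed.

(** By the invariant, every unstable cell other than [s.2] has [U]-value below [k], so [s.2] is the
    maximal one. *)
Lemma pivot_dropping k s : dropping k s -> unstable s.1 s.2 -> pivot U s.1 = Some s.2.
Proof.
case: s => T p [/= kp s1 s2] up.
have Up z : unstable T z -> U z <= U p.
  move=> uz; have [->//|zp] := eqVneq z p; case: (ltnP (U z) k) => kz.
    exact: leq_trans (ltnW kz) kp.
  move: uz; rewrite /unstable; case zy: min_nbr => [y|//].
  by have := s1 _ _ zp kz (min_nbr_in zy); lia.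
rewrite /pivot; case: pickP => [x /andP[ux /forallP xP]|/(_ p)].
  congr Some; apply/eqP; rewrite -(tableau_eq U) eqn_leq Up //=.
  by have /implyP -> := xP p.
by rewrite up /= => /negP[]; apply/forallP => z; apply/implyP/Up.
Qed.

Lemma nps_step_dropping k s : dropping k s -> unstable s.1 s.2 ->
  nps_step U s.1 = (drop_step s).1.
Proof.
move=> dr us; rewrite /nps_step (pivot_dropping dr us) /drop_step.
by move: us; rewrite /unstable; case: min_nbr => // y ->.
Qed.

Lemma unstable_nonstandard T x : unstable T x -> ~~ standard T.
Proof.
rewrite /unstable; case xy: min_nbr => [y|//] lt_yx; apply/negP => sT.
by have := standard_nplus sT (min_nbr_in xy); lia.
Qed.

Definition state k x d T : tableau lam * cell lam := iter d drop_step (after k.+1 T, x).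

Lemma dropping_state k x d T : U x = k :> nat -> dropping k (state k x d T).
Proof.
move=> Ux; have lt_kn : k < n by rewrite -Ux.
elim: d => [|d IHd]; first exact/dropping_start/after_sorted.
rewrite /state iterS; have [->//|/(drop_stepP IHd)[]//] := eqVneq (drop_step (state k x d T)) (state k x d T).
Qed.

(** Idle iterations happen exactly at stable states, so only proper exchanges are counted. *)
Definition exchanges k x T : nat := \sum_(d < depth) unstable (state k x d T).1 (state k x d T).2.

(** The second clause makes [s] the exact step count as soon as [S] is standard. *)
Definition nps_reach (s : nat) T S : Prop :=
  iter s (nps_step U) T = S /\ forall s', s' < s -> ~~ standard (iter s' (nps_step U) T).

Lemma nps_reach_state x d s T : nps_reach s T (after (U x).+1 T) ->
  nps_reach (s + \sum_(q < d) unstable (state (U x) x q T).1 (state (U x) x q T).2)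
    T (state (U x) x d T).1.
Proof.
move=> rT; elim: d => [|d [IH1 IH2]]; first by rewrite big_ord0 addn0.
rewrite big_ord_recr /= addnA -/(state _ _ d T).
have := drop_step_unstable (state (U x) x d T).
case us: unstable => /= fx; last first.
  by rewrite addn0; split; rewrite // IH1; move/negbFE/eqP: fx => ->.
rewrite addn1; split.
  by rewrite iterS IH1 (nps_step_dropping (dropping_state d T (erefl _)) us).
move=> s'; rewrite ltnS leq_eqVlt => /orP[/eqP ->|/IH2 //].
by rewrite IH1; apply: unstable_nonstandard us.
Qed.

Lemma nps_reach_after k T : k <= n ->
  nps_reach (\sum_(x | k <= U x) exchanges (U x) x T) T (after k T).
Proof.
move: k; apply: round_ind => [|x].
  by rewrite after_n big1 // => x; have := ltn_ord (U x); lia.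
rewrite (after_step _ (erefl _)) => /(@nps_reach_state _ depth).
rewrite [in X in _ -> X](bigD1 x) //= addnC.
rewrite (eq_bigl (fun y => (U x <= U y) && (y != x))) // => y.
by rewrite ltn_neqAle eq_sym (tableau_eq U) andbC.
Qed.

Lemma nps_after T :
  nps_result U T = after 0 T /\ nps_count U T = \sum_x exchanges (U x) x T.
Proof.
have [r1 r2] := nps_reach_after T (leq0n n).
have cnt : nps_count U T = \sum_x exchanges (U x) x T.
  rewrite /nps_count; case: ex_minnP => m sm minm; apply/eqP; rewrite eqn_leq.
  by rewrite minm ?r1 -?sorted_from0 ?after_sorted // leqNgt; apply/negP => /r2; rewrite sm.
by split; rewrite // /nps_result cnt.
Qed.

Lemma standard_nps_result T : standard (nps_result U T).
Proof. by have [-> _] := nps_after T; rewrite -sorted_from0 after_sorted. Qed.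

End Rounds.

(** * Complexity *)

Section Relabel.

Variables (n : nat) (lam : integer_partition n) (v v' : 'I_n).

Implicit Types (S T : tableau lam) (x y z : cell lam) (s : tableau lam * cell lam).

Lemma relabel_bij T : bijb [ffun z => tperm v v' (T z)].
Proof.
have /andP[_ /forallP surjT] := entries_bij T.
apply/andP; split.
  by apply/injectiveP => a b; rewrite !ffunE => /perm_inj /tableau_inj.
apply/forallP => k; have /existsP[z /eqP Tz] := surjT (tperm v v' k).
by apply/existsP; exists z; rewrite ffunE Tz tpermK.
Qed.

Definition relabel T : tableau lam := Tableau (relabel_bij T).

Lemma relabelE T z : relabel T z = tperm v v' (T z).
Proof. by rewrite /= ffunE. Qed.

Lemma relabel_inj : injective relabel.
Proof.
move=> S T eqST; apply: tableau_ext => z; congr nat_of_ord.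
by apply: (@perm_inj _ (tperm v v')); rewrite -!relabelE eqST.
Qed.

Lemma relabel_exchange T x y : exchange (relabel T) x y = relabel (exchange T x y).
Proof. by apply: tableau_ext => z; rewrite relabelE !exchangeE relabelE. Qed.

Hypothesis adj : v = v'.+1 :> nat \/ v' = v.+1 :> nat.

(** Adjacent values compare alike with every third value. Only the comparison of [v] with [v'] could
    be affected, and it is excluded. *)
Lemma tperm_adj_le (a b : 'I_n) : a != v -> b != v -> (tperm v v' a <= tperm v v' b) = (a <= b).
Proof.
move=> /eqP av /eqP bv.
have ne (c d : 'I_n) : c <> d -> (c : nat) <> d by move=> cd /val_inj.
move: (ne _ _ av) (ne _ _ bv).
case: (tpermP v v' a) => [//|ea|_ /ne]; case: (tpermP v v' b) => [//|eb|_ /ne];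
  try rewrite ea; try rewrite eb; lia.
Qed.

Lemma min_nbr_relabel T x :
  (forall z, z \in nplus x -> T z != v) -> min_nbr (relabel T) x = min_nbr T x.
Proof.
move=> nv; apply: eq_pick => y /=; case xy: (y \in nplus x) => //=.
apply: eq_forallb => z; case xz: (z \in nplus x) => //=.
by rewrite !ffunE tperm_adj_le ?nv.
Qed.

Definition relabel_state s := (relabel s.1, s.2).

(** Either [v] takes part in no comparison of this step, or the dropping entry is exchanged with one
    smaller than both [v] and [v']; the swap changes neither outcome. *)
Lemma drop_step_relabel s :
  (forall z, z \in nplus s.2 -> s.1 z != v) ->
  s.1 s.2 != v \/ (exists2 y, min_nbr s.1 s.2 = Some y & s.1 y < v /\ s.1 y < v') ->
  drop_step (relabel_state s) = relabel_state (drop_step s).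
Proof.
case: s => T p /= nv alt; rewrite /drop_step [LHS]/= min_nbr_relabel //=.
case py: (min_nbr T p) => [y|//]; have yp := min_nbr_in py.
rewrite !ffunE relabel_exchange.
have -> : (tperm v v' (T y) < tperm v v' (T p)) = (T y < T p).
  case: alt => [pv|[z zp [zv zv']]]; first by rewrite !ltnNge tperm_adj_le ?pv ?(nv _ yp).
  move: zp; rewrite py => -[ezy]; subst z.
  rewrite [tperm v v' (T y)]tpermD; [|by apply/eqP => e; rewrite e in zv zv'; lia..].
  case: tpermP => [->|->|]; lia.
by case: ifP.
Qed.

End Relabel.

(** * The average gain of potential per exchange *)

Section Exchanges.

Variables (n : nat) (lam : integer_partition n) (U : syt lam).

Implicit Types (S T : tableau lam) (x y z w p : cell lam) (k d : nat).

Lemma state_below x d T z : U z < U x -> (state U (U x) x d T).1 z = after U (U x).+1 T z.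
Proof.
move=> zx; elim: d => [//|d <-]; rewrite /state iterS -/(state _ _ _ _ _).
have [kp _ _] := dropping_state d T (erefl (U x : nat)).
case: (state _ _ _ _ _) kp => S p /= kp; rewrite /drop_step /=.
case py: min_nbr => [y|//]; case: ifP => // _.
have py' := syt_nplus U (min_nbr_in py).
by rewrite exchangeD //; apply/eqP => e; subst z; lia.
Qed.

Lemma after_below k T z : k <= n -> U z < k -> after U k T z = T z.
Proof.
move: k; apply: (@round_ind _ _ U) => [_|x IHx zx]; first by rewrite after_n.
rewrite (after_step _ (erefl (nat_of_ord (U x)))) -[X in X.1]/(state U (U x) x _ T).
by rewrite state_below ?IHx // ltnW.
Qed.

Lemma state_entry x d T : (state U (U x) x d T).1 (state U (U x) x d T).2 = T x.
Proof.
elim: d => [|d]; first by rewrite /= after_below.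
rewrite /state iterS -/(state _ _ _ _ _); case: (state _ _ _ _ _) => S p /=.
rewrite /drop_step /=; case py: min_nbr => [y|//]; case: ifP => // _.
by rewrite exchangeR.
Qed.

Definition smaller (s : tableau lam * cell lam) : option 'I_n :=
  if min_nbr s.1 s.2 is Some y then
    if s.1 y < s.1 s.2 then Some (s.1 y) else None
  else None.

Lemma smaller_unstable s : unstable s.1 s.2 = isSome (smaller s).
Proof. by rewrite /unstable /smaller; case: min_nbr => // y; case: ifP. Qed.

Lemma smallerP s b : smaller s = Some b ->
  exists y, [/\ min_nbr s.1 s.2 = Some y, s.1 y = b, b < s.1 s.2 &
    drop_step s = (exchange s.1 s.2 y, y)].
Proof.
rewrite /smaller /drop_step; case py: min_nbr => [y|//]; case: ifP => // lt_y [<-].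
by exists y.
Qed.

Section RelabelRun.

Variables (v v' : 'I_n).
Hypothesis adj : v = v'.+1 :> nat \/ v' = v.+1 :> nat.

(** As long as the round of the cell holding [v] has not begun, [v] is not compared with
    anything. *)
Lemma after_relabel T k : k <= n -> (forall z, T z = v -> U z < k) ->
  after U k (relabel v v' T) = relabel v v' (after U k T).
Proof.
move: k; apply: (@round_ind _ _ U) => [_|x IHx belowP]; first by rewrite !after_n.
have [z0 Tz0] := tableau_surj T (ltn_ord v).
have {}Tz0 : T z0 = v by apply: val_inj.
have lt0 := belowP _ Tz0.
rewrite !(after_step _ (erefl (nat_of_ord (U x)))) -![X in X.1]/(state U (U x) x (depth lam) _).
rewrite (_ : state _ _ _ _ (relabel v v' T) = relabel_state v v' (state U (U x) x (depth lam) T)) //.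
elim: (depth lam) => [|d IHd].
  by rewrite /state /= IHx // => z /belowP/ltnW.
rewrite /state !iterS -!/(state _ _ _ _ _) IHd.
have nv z : U x <= U z -> (state U (U x) x d T).1 z != v.
  move=> xz; apply/eqP; rewrite -Tz0 -(after_below T (ltn_ord (U x))) ?(leqW lt0) //.
  rewrite -(state_below d T lt0) => /tableau_inj ezz.
  by rewrite ezz in xz; lia.
have [kp _ _] := dropping_state d T (erefl (U x : nat)).
apply: drop_step_relabel => // [z pz|]; last by left; apply: nv.
by apply: nv; have := syt_nplus U pz; lia.
Qed.

(** The entries met by the dropping entry increase along its way. Those met before [b] are therefore
    below both [v] and [v'], and the run up to step [d] cannot tell [v] from [v']. *)
Lemma state_relabel x d T b : T x = v ->
  smaller (state U (U x) x d T) = Some b -> b < v' ->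
  state U (U x) x d (relabel v v' T) = relabel_state v v' (state U (U x) x d T).
Proof.
move=> Tx; elim: d b => [|d IHd] b.
  move=> _ _; rewrite /state /= after_relabel // => z Tz.
  by move: Tz; rewrite -Tx => /tableau_inj ->.
rewrite /state !iterS -!/(state _ _ _ _ _) => sm lt_b.
have dr := dropping_state d T (erefl (U x : nat)).
have ent := state_entry x d T.
case sm': (smaller (state U (U x) x d T)) => [b'|]; last first.
  have := drop_step_unstable (state U (U x) x d T).
  by rewrite smaller_unstable sm' /= => /negbFE/eqP fx; rewrite fx sm' in sm.
have [y [py yb lt_b' ds]] := smallerP sm'.
(* [b] sits in a successor of the cell [y] that held [b'], and these cells are in order. *)
have lt_bb : b' < b.
  move: sm; rewrite ds => /smallerP[w /= [yw <- _ _]].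
  have yw' := min_nbr_in yw; have py' := min_nbr_in py.
  rewrite -yb exchangeD ?(nplus_neq yw') //; first last.
    by apply/eqP => e; subst w; have := rank_nplus py'; have := rank_nplus yw'; lia.
  have [kp s1 _] := dr; apply: s1 => //; first exact: nplus_neq py'.
  by have := syt_nplus U py'; lia.
rewrite (IHd b') //; last exact: ltn_trans lt_b.
apply: drop_step_relabel => // [z pz|].
  by rewrite -Tx -ent (inj_eq (@tableau_inj _ _ _)) (nplus_neq pz).
right; exists y => //; rewrite yb; split; last exact: ltn_trans lt_b.
by rewrite -Tx -ent.
Qed.

Lemma smaller_relabel x d T b : T x = v ->
  smaller (state U (U x) x d T) = Some b -> b < v' ->
  smaller (state U (U x) x d (relabel v v' T)) = Some b.
Proof.
move=> Tx sm lt_b; rewrite (state_relabel Tx sm lt_b).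
have := state_entry x d T; case: (state _ _ _ _ _) sm => S p sm /= ent.
have [y [/= py yb lt_bp _]] := smallerP sm.
rewrite /smaller [_.2]/= [_.1]/= min_nbr_relabel // => [|z pz]; last first.
  by rewrite -Tx -ent (inj_eq (@tableau_inj _ _ _)) (nplus_neq pz).
rewrite py !relabelE ent Tx tpermL yb tpermD ?lt_b //.
  by apply/eqP => e; rewrite ent Tx e in lt_bp; lia.
by apply/eqP => e; rewrite e in lt_b; lia.
Qed.

End RelabelRun.

Definition exchange_set x d (b m : 'I_n) : {set tableau lam} :=
  [set T : tableau lam | (T x == m) && (smaller (state U (U x) x d T) == Some b)].

Lemma card_exchange_le x d (b v v' : 'I_n) : v = v'.+1 :> nat \/ v' = v.+1 :> nat ->
  b < v' -> #|exchange_set x d b v| <= #|exchange_set x d b v'|.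
Proof.
move=> adj lt_b; rewrite -(card_imset _ (@relabel_inj _ lam v v')).
apply/subset_leq_card/subsetP => S /imsetP[T + ->]; rewrite !inE => /andP[/eqP Tx /eqP sm].
by rewrite relabelE Tx tpermL (smaller_relabel adj Tx sm lt_b) !eqxx.
Qed.

Lemma card_exchange x d (b m m' : 'I_n) :
  b < m -> b < m' -> #|exchange_set x d b m| = #|exchange_set x d b m'|.
Proof.
wlog le_m : m m' / m <= m' => [IH|bm bm'].
  by case: (leqP m m') => [|/ltnW] le_m bm bm'; [|symmetry]; apply: IH.
have [q] : exists q, m' = m + q :> nat by exists (m' - m); lia.
elim: q m' {le_m} bm' => [|q IHq] m' bm' em'.
  by congr #|exchange_set _ _ _ _|; apply: val_inj; rewrite /= em' addn0.
have lt_q : m + q < n by have := ltn_ord m'; lia.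
rewrite (IHq (Ordinal lt_q)) //=; last by lia.
by apply/eqP; rewrite eqn_leq !card_exchange_le //= ?em'; lia.
Qed.

Local Open Scope ring_scope.

(* Moving an entry [m] one step away from the corner in exchange for a smaller
   entry [b] changes the potential by [harm m - harm b], whose sum over all
   [m > b] is the number of these [m]. *)
Definition harm (m : nat) : rat := \sum_(0 <= v < m.+1) (n - v)%:R^-1.

Definition potential T : rat := \sum_x (rank x)%:R * harm (T x).

(** Double counting: [1 / (n - v)] occurs in [harm m - harm b] for the [M - v] values [m] from [v]
    to [M - 1]. For [M = n] every summand on the right becomes 1. *)
Lemma harm_sum (b M : nat) :
  \sum_(b.+1 <= m < M) (harm m - harm b) = \sum_(b.+1 <= v < M) (M - v)%:R / (n - v)%:R.
Proof.
elim: M => [|M IHM]; first by rewrite !big_geq.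
have [lt_Mb|le_bM] := ltnP M b.+1; first by rewrite !big_geq.
rewrite big_nat_recr //= IHM [RHS](eq_big_nat _ _ (F2 := fun v => (M - v)%:R / (n - v)%:R + (n - v)%:R^-1)).
  rewrite big_split /= [X in _ = X + _]big_nat_recr //= subnn mul0r addr0; congr (_ + _).
  have -> : harm M = harm b + \sum_(b.+1 <= v < M.+1) (n - v)%:R^-1.
    by rewrite /harm -big_cat_nat //= ltnW.
  by rewrite [harm b + _]addrC addrK.
move=> v /andP[_ lt_v]; rewrite ltnS in lt_v.
by rewrite subSn // -natr1 mulrDl mul1r.
Qed.

Lemma harm_sum_above (b : 'I_n) : \sum_(m < n | (b < m)%N) (harm m - harm b - 1) = 0.
Proof.
have E : \sum_(b.+1 <= v < n) (n - v)%:R / (n - v)%:R = \sum_(b.+1 <= v < n) 1 :> rat.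
  apply: eq_big_nat => v /andP[_ lt_v].
  by rewrite divff // pnatr_eq0 subn_eq0 -ltnNge.
move: (harm_sum b n); rewrite E => /eqP; rewrite -subr_eq0 -sumrB => /eqP E'; rewrite -[RHS]E'.
rewrite -(big_mkord (fun m => (b < m)%N) (fun m => harm m - harm b - 1)).
rewrite [LHS](@big_cat_nat _ _ _ b.+1) //= [X in X + _]big_nat_cond big_pred0 ?add0r.
  rewrite [LHS]big_nat_cond [RHS]big_nat_cond; apply: eq_bigl => m.
  by rewrite andbT; case: (b < m)%N; rewrite ?andbF ?andbT.
by move=> m; rewrite ltnS; case: leqP; rewrite ?andbF.
Qed.

Lemma potential_step s b : smaller s = Some b ->
  potential (drop_step s).1 - potential s.1 = harm (s.1 s.2) - harm b.
Proof.
case: s => T p /smallerP[y [/= py yb lt_b ->]] /=.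
have yp := min_nbr_in py; have rk := rank_nplus yp; have ne := nplus_neq yp.
move: (exchangeL T p y) (exchangeR T p y) (@exchangeD _ _ T p y).
move: (exchange T p y) => T' E1 E2 E3.
rewrite /potential -sumrB (bigD1 p) //= (bigD1 y) //= big1 ?addr0; last first.
  by move=> z /andP[zp zy]; rewrite E3 // subrr.
by rewrite E1 E2 yb rk -natr1; ring.
Qed.

(** Tableaux are grouped by the exchanged entry [b] and the dropping entry [m]. By [card_exchange]
    the size of a group does not depend on [m], so it factors out of the vanishing sum
    [harm_sum_above]. *)
Lemma sum_exchange_gain x d :
  \sum_T (if smaller (state U (U x) x d T) is Some b then harm (T x) - harm b - 1 else 0) = 0.
Proof.
pose G (b m : 'I_n) := harm m - harm b - 1.
transitivity (\sum_(b < n) \sum_(m < n | (b < m)%N) #|exchange_set x d b m|%:R * G b m).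
  transitivity (\sum_T \sum_(b < n) \sum_(m < n | (b < m)%N) (T \in exchange_set x d b m)%:R * G b m).
    apply: eq_bigr => T _; case sm: smaller => [b|]; last first.
      by rewrite big1 // => b _; rewrite big1 // => m _; rewrite inE sm andbF mul0r.
    rewrite (bigD1 b) //= (bigD1 (T x)) /=; last first.
      by have [y [_ _ + _]] := smallerP sm; rewrite state_entry.
    rewrite inE sm !eqxx mul1r big1 ?addr0 => [|m /andP[_ nm]]; last first.
      by rewrite inE eq_sym (negPf nm) mul0r.
    rewrite big1 ?addr0 // => b' nb; rewrite big1 // => m _.
    by rewrite inE sm andbC eqE /= eq_sym (negPf nb) mul0r.
  rewrite exchange_big; apply: eq_bigr => b _; rewrite exchange_big.
  apply: eq_bigr => m _; rewrite -mulr_suml -natr_sum; congr (_%:R * _).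
  by rewrite -sum1_card [RHS]big_mkcond; apply: eq_bigr => T _; case: (T \in _).
apply: big1 => b _; case: (pickP (fun m : 'I_n => (b < m)%N)) => [m0 bm0|none]; last first.
  by rewrite big_pred0.
rewrite (eq_bigr (fun m => #|exchange_set x d b m0|%:R * G b m)) => [|m bm].
  by rewrite -mulr_sumr harm_sum_above mulr0.
by rewrite (card_exchange x d bm bm0).
Qed.

(** At each fixed position [d] the number of exchanges equals the total gain of potential; the gains
    telescope in [d]. *)
Lemma sum_exchanges_round x :
  \sum_T (exchanges U (U x) x T)%:R =
  \sum_T potential (after U (U x) T) - \sum_T potential (after U (U x).+1 T).
Proof.
pose st d T := state U (U x) x d T.
transitivity (\sum_T \sum_(0 <= d < depth lam) (potential (st d.+1 T).1 - potential (st d T).1)).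
  apply: etrans (_ : \sum_T \sum_(0 <= d < depth lam) (unstable (st d T).1 (st d T).2)%:R = _).
    by apply: eq_bigr => T _; rewrite /exchanges natr_sum big_mkord.
  rewrite exchange_big [RHS]exchange_big; apply: eq_bigr => d _ /=.
  apply/eqP; rewrite eq_sym -subr_eq0 -sumrB -[X in _ == X](sum_exchange_gain x d).
  apply/eqP/eq_bigr => T _; rewrite smaller_unstable -/(st d T).
  case sm: smaller => [b|].
    by rewrite (potential_step sm) state_entry.
  have := drop_step_unstable (st d T); rewrite smaller_unstable sm => /negbFE/eqP fx.
  by rewrite fx subrr subr0.
rewrite -sumrB; apply: eq_bigr => T _.
by rewrite telescope_sumr // (after_step _ (erefl (nat_of_ord (U x)))).
Qed.

Lemma sum_nps_count :
  (\sum_T nps_count U T)%:R = \sum_T potential (nps_result U T) - \sum_T potential T.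
Proof.
have E k : (k <= n)%N -> \sum_(x | (k <= U x)%N) \sum_T (exchanges U (U x) x T)%:R =
    \sum_T potential (after U k T) - \sum_T potential T.
  move: k; apply: (@round_ind _ _ U) => [|x IHx].
    rewrite big_pred0 => [|x]; last by have := ltn_ord (U x); lia.
    by under [X in X - _]eq_bigr do rewrite after_n; rewrite subrr.
  rewrite (bigD1 x) //= sum_exchanges_round.
  rewrite (eq_bigl (fun y => (U x).+1 <= U y)%N) ?IHx ?addrA ?subrK // => y.
  by rewrite [RHS]ltn_neqAle eq_sym (tableau_eq U) andbC.
rewrite natr_sum (eq_bigr (fun T => \sum_x (exchanges U (U x) x T)%:R)) => [|T _]; last first.
  by have [_ ->] := nps_after U T; rewrite natr_sum.
rewrite exchange_big; apply: (etrans (E 0%N (leq0n n))); congr (_ - _); apply: eq_bigr => T _.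
by have [-> _] := nps_after U T.
Qed.

Lemma sum_potential_result :
  \sum_T potential (nps_result U T) =
  \sum_(W : syt lam) (distribution U W)%:R * potential W.
Proof.
rewrite (partition_big (fun T => Syt (standard_nps_result U T)) xpredT) //=.
apply: eq_bigr => W _; rewrite ffunE -sum1_card natr_sum mulr_suml.
rewrite [RHS](eq_bigl (fun T => Syt (standard_nps_result U T) == W)) => [|T]; last first.
  by rewrite inE -val_eqE.
by apply: eq_bigr => T /eqP <-; rewrite mul1r.
Qed.

End Exchanges.

Lemma eq_distribution_complexity (n : nat) (lam : integer_partition n) (U V : syt lam) :
  distribution U = distribution V -> complexity U = complexity V.
Proof. by move=> eqUV; rewrite /complexity !sum_nps_count !sum_potential_result eqUV. Qed.

(** * Uniformity *)

Section ColumnOrder.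

Variables (n : nat) (lam : integer_partition n) (U : syt lam).

(* Rows and columns are kept abstract so that everything also applies to the
   transposed diagram: [L h] is the length of row [h], [M c] that of column [c]. *)
Variables (rr cc : cell lam -> nat) (L M : nat -> nat).
Hypothesis nplusE : forall x y, (y \in nplus x) =
  (rr y == (rr x).+1) && (cc y == cc x) || (rr y == rr x) && (cc y == (cc x).+1).
Hypothesis coord_inj : forall x y, rr x = rr y -> cc x = cc y -> x = y.
Hypothesis coord_lt : forall x, cc x < L (rr x).
Hypothesis coord_ex : forall h c, c < L h -> exists x, rr x = h /\ cc x = c.
Hypothesis ML : forall h c, (h < M c) = (c < L h).
Hypothesis colU : forall x y, rr y = (rr x).+1 -> cc y = cc x -> U y = (U x).+1 :> nat.

Implicit Types (S T : tableau lam) (x y z w : cell lam) (i j h c k : nat).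

Lemma L_mono h h' : h <= h' -> L h' <= L h.
Proof.
move=> le_h; rewrite leqNgt; apply/negP; rewrite -ML => /(leq_ltn_trans le_h).
by rewrite ML ltnn.
Qed.

Lemma column_U x y d : rr y = rr x + d -> cc y = cc x -> U y = U x + d :> nat.
Proof.
elim: d y => [|d IHd] y ry cy.
  by rewrite addn0 (@coord_inj y x) // ry addn0.
have [|z [rz cz]] := @coord_ex (rr x + d) (cc x).
  by rewrite -cy; apply: leq_trans (coord_lt y) (L_mono _); rewrite ry; lia.
by rewrite addnS -(IHd z) //; apply: colU; rewrite ?ry ?rz ?cz ?addnS.
Qed.

Lemma row_U x y d : rr y = rr x -> cc y = cc x + d.+1 -> U x < U y.
Proof.
elim: d y => [|d IHd] y ry cy.
  by apply: syt_nplus; rewrite nplusE; lia.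
have [|z [rz cz]] := @coord_ex (rr x) (cc x + d.+1).
  by have := coord_lt y; rewrite ry; lia.
by apply: ltn_trans (IHd z _ _) _ => //; apply: syt_nplus; rewrite nplusE; lia.
Qed.

(** Each column carries consecutive values. If [U y <= U x], the value at the top [y0] of the column
    of [y] would fall between those of [x0] and [x], putting [y0] into the column of [x]. *)
Lemma column_U_lt x y : cc x < cc y -> U x < U y.
Proof.
move=> lt_c.
have row0 z : exists z0, rr z0 = 0 /\ cc z0 = cc z.
  by apply: coord_ex; apply: leq_trans (coord_lt z) (L_mono _).
have [[x0 [rx0 cx0]] [y0 [ry0 cy0]]] := (row0 x, row0 y).
have Ux : U x = U x0 + rr x :> nat by apply: column_U; rewrite ?rx0 ?cx0.
have Uy : U y = U y0 + rr y :> nat by apply: column_U; rewrite ?ry0 ?cy0.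
have lt0 : U x0 < U y0 by apply: (@row_U _ _ (cc y - cc x).-1); lia.
rewrite ltnNge; apply/negP => le_yx.
have [|z [rz cz]] := @coord_ex (U y0 - U x0) (cc x).
  by apply: leq_trans (coord_lt x) (L_mono _); lia.
have Uz : U z = U x0 + (U y0 - U x0) :> nat by apply: column_U; lia.
have ezy : z = y0 by apply/eqP; rewrite -(tableau_eq U) Uz; lia.
by move: lt_c; rewrite -cz -cy0 ezy ltnn.
Qed.

Lemma le_U x z : (U x <= U z) = (cc x < cc z) || (cc x == cc z) && (rr x <= rr z).
Proof.
case: (ltngtP (cc x) (cc z)) => [/column_U_lt/ltnW -> //|/column_U_lt|ec] /=.
  by move=> lt_zx; apply/negbTE; rewrite -ltnNge.
case: (leqP (rr x) (rr z)) => [le_r|lt_r].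
  by rewrite (@column_U x z (rr z - rr x)) ?leq_addr //; lia.
by rewrite (@column_U z x (rr x - rr z)) //; lia.
Qed.

(** Columns are counted from [j], so that column [j] becomes the column 0 of [exit_col]. Positions
    outside the diagram read 0. *)
Definition val_at j T h c : nat :=
  if [pick z | (rr z == h) && (cc z == j + c)] is Some z then nat_of_ord (T z) else 0.

Lemma val_atE j T h c z : rr z = h -> cc z = j + c -> val_at j T h c = T z.
Proof.
move=> rz cz; rewrite /val_at; case: pickP => [w /andP[/eqP rw /eqP cw]|/(_ z)].
  by rewrite (@coord_inj w z) ?rw ?cw.
by rewrite rz cz !eqxx.
Qed.

Lemma sum_cells i j (F : nat -> nat -> nat) :
  \sum_(y | (i <= rr y) && (j <= cc y)) F (rr y) (cc y - j) =
  \sum_(i <= a < M j) \sum_(c < L a - j) F a c.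
Proof.
have E a c : c < L a - j -> \sum_y ((rr y == a) && (cc y == j + c)) = 1.
  move=> lt_c; have [|z [rz cz]] := @coord_ex a (j + c); first by lia.
  rewrite (bigD1 z) //= rz cz !eqxx big1 // => y yz; apply/eqP; rewrite eqb0.
  by apply: contraNN yz => /andP[/eqP ry /eqP cy]; apply/eqP/coord_inj; rewrite ?ry ?cy.
transitivity (\sum_y \sum_(i <= a < M j) \sum_(c < L a - j)
    ((rr y == a) && (cc y == j + c)) * F a c); last first.
  rewrite exchange_big; apply: eq_bigr => a _; rewrite exchange_big; apply: eq_bigr => c _.
  by rewrite -big_distrl /= E ?mul1n.
rewrite big_mkcond; apply: eq_bigr => y _.
under eq_bigr => a _ do under eq_bigr => c _ do rewrite -mulnb -mulnA.
under eq_bigr => a _ do rewrite -big_distrr /=.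
have inner a : \sum_(c < L a - j) (cc y == j + c) * F a c =
    (j <= cc y < L a) * F a (cc y - j).
  case: (boolP (j <= cc y < L a)) => [/andP[jc cL]|nc].
    have lt_c : cc y - j < L a - j by lia.
    rewrite (bigD1 (Ordinal lt_c)) //= subnKC // eqxx big1 ?addn0 // => c.
    by move=> /eqP nc; case: eqP => // e; case: nc; apply: val_inj => /=; lia.
  by apply: big1 => c _; case: eqP => // e; have := ltn_ord c; lia.
under eq_bigr => a _ do rewrite inner.
transitivity (\sum_(i <= a < M j | a == rr y) (j <= cc y < L a) * F a (cc y - j)).
  rewrite big_nat1_eq ML coord_lt andbT.
  have cy := coord_lt y; case: (leqP j (cc y)) => jy.
    by rewrite (leq_ltn_trans jy cy) mul1n andbT.
  by rewrite mul0n !andbF if_same.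
rewrite [LHS]big_mkcond; apply: eq_bigr => a _.
by rewrite eq_sym; case: (rr y == a); rewrite ?mul1n.
Qed.

Lemma undrop_row_le k s : rr (undrop_step U k s).2 <= rr s.2.
Proof.
rewrite /undrop_step; case E: max_pred => [w|//=].
by have [+ _ _] := max_predP E; rewrite nplusE /=; lia.
Qed.

Lemma undrop_row_iter_le k d s : rr (iter d (undrop_step U k) s).2 <= rr s.2.
Proof. by elim: d => //= d; apply: leq_trans (undrop_row_le _ _). Qed.

(* When the rounds of column [j] have reached row [i], a tableau [T] sorted so far
   arises from a constant multiple of [col_weight j i T] initial tableaux. *)
Definition col_weight j i T : nat :=
  \prod_(i <= h < M j)
    (M j - h.+1 + \sum_(c < L h - j) (entry (exit_col (val_at j T)) (h - i).+1 h c < 1)).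

(** The weight before the round of the cell in row [i]: it agrees with [col_weight j i.+1], and is
    an empty product when that cell is the lowest of its column. *)
Definition tail_weight j i T : nat :=
  \prod_(i.+1 <= h < M j)
    (M j - h.+1 + \sum_(c < L h - j) (entry (exit_col (val_at j T)) (h - i) h c == 0)).

(** * Undoing the round of one cell *)

Section Round.

Variables (x : cell lam) (T : tableau lam).
Local Notation i := (rr x).
Local Notation j := (cc x).
Local Notation k := (nat_of_ord (U x)).
Local Notation V := (val_at (cc x) T).
Local Notation len := (fun h => L h - cc x).

Hypothesis sT : sorted_from U k T.

Lemma len_mono h h' : h <= h' -> len h' <= len h.
Proof. by move=> /L_mono; apply: leq_sub2r. Qed.

Lemma val_at_row h c : i <= h -> c.+1 < len h -> V h c < V h c.+1.
Proof.
move=> le_ih lt_c.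
have [|z [rz cz]] := @coord_ex h (j + c); first by lia.
have [|w [rw cw]] := @coord_ex h (j + c.+1); first by lia.
rewrite (val_atE T rz cz) (val_atE T rw cw); apply: (sorted_fromP _ _ _ sT).
  by rewrite le_U; lia.
by rewrite nplusE; lia.
Qed.

Lemma val_at_col h c : i <= h -> c < len h.+1 -> V h c < V h.+1 c.
Proof.
move=> le_ih lt_c; have := L_mono (leqnSn h) => le_L.
have [|z [rz cz]] := @coord_ex h (j + c); first by lia.
have [|w [rw cw]] := @coord_ex h.+1 (j + c); first by lia.
rewrite (val_atE T rz cz) (val_atE T rw cw); apply: (sorted_fromP _ _ _ sT).
  by rewrite le_U; lia.
by rewrite nplusE; lia.
Qed.

Section Undrop.

Variable y : cell lam.
Hypotheses (le_iy : i <= rr y) (le_jy : j <= cc y).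
Local Notation a := (rr y).
Local Notation b0 := (cc y - cc x).
Local Notation beta := (path_col V a b0).

(* Entries after the backward slide has reached relative position [(h, c)]. *)
Definition shifted h c h' c' : nat :=
  if on_path V i a b0 h' c' && ((h < h') || (h == h') && (c < c')) then
    if c' == beta h' then V h'.-1 c' else V h' c'.-1
  else V h' c'.

(** The backward slide follows the path; induction on the distance left to [x]. [S] is not described
    at [z], which holds the moving entry. *)
Lemma undrop_track m z S :
  (rr z - i) + (cc z - j) <= m -> i <= rr z <= a -> j <= cc z ->
  beta (rr z) <= cc z - j <= beta (rr z).+1 ->
  (forall w, w != z -> j <= cc w -> S w = shifted (rr z) (cc z - j) (rr w) (cc w - j) :> nat) ->
  exists t S' z', [/\ iter t (undrop_step U k) (S, z) = (S', z'),
    rr z' = i, cc z' = j + beta i &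
    forall w, w != z' -> j <= cc w -> S' w = shifted i (beta i) (rr w) (cc w - j) :> nat].
Proof.
elim: m z S => [|m IHm] z S le_m iza jz bz Sz.
  exists 0, S, z; rewrite (_ : rr z = i) in bz Sz *; last by lia.
  by rewrite (_ : beta i = cc z - j) ?subnKC //; lia.
have bE : beta (rr z) = exit_col V (rr z) (beta (rr z).+1) by apply: path_colE; lia.
have Sold w : w != z -> j <= cc w ->
    (rr w < rr z) || (rr w == rr z) && (cc w <= cc z) -> S w = V (rr w) (cc w - j) :> nat.
  move=> wz jw before; rewrite Sz // /shifted ifF //; apply/negbTE; rewrite negb_and.
  by apply/orP; right; lia.
have [lt_b|le_b] := ltnP (beta (rr z)) (cc z - j).
(* Right of the exit column the slide moves left. *)
- have [|w [rw cw]] := @coord_ex (rr z) (cc z).-1.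
    by have := coord_lt z; lia.
  have wz : w != z by apply/eqP => e; subst w; lia.
  have not_up : ~~ goes_up V (rr z) (cc z - j).
    by apply: contraL lt_b => up; rewrite -leqNgt bE; apply: exit_col_max up; lia.
  have step : undrop_step U k (S, z) = (exchange S w z, w).
    apply/undrop_stepE/max_predE; first by rewrite nplusE; lia.
      by rewrite le_U; lia.
    move=> v zv kv; have [->//|vw] := eqVneq v w; move: kv; rewrite le_U => kv.
    move: zv; rewrite nplusE => /orP[/andP[/eqP rv /eqP cv]|/andP[/eqP rv /eqP cv]]; last first.
      by case/eqP: vw; apply: coord_inj; lia.
    have vz : v != z by apply/eqP => e; subst v; lia.
    rewrite !Sold //; try lia.
    move: not_up; rewrite /goes_up negb_or => /andP[_].
    by rewrite rw cw rv -cv /= -leqNgt (_ : (cc z - j).-1 = (cc z).-1 - j) //; lia.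
  have := IHm w (exchange S w z); case=> [|||||t [S' [z' [it rz' cz' S'E]]]]; try lia.
  + by rewrite rw cw; lia.
  + move=> u uw ju; have [->|uz] := eqVneq u z.
      rewrite exchangeR Sold // ?rw ?cw; try lia.
      rewrite /shifted /on_path ifT; last by lia.
      by rewrite ifF; [congr (V _ _)|]; lia.
    rewrite exchangeD // Sz // /shifted rw cw.
    have /eqP/negP nuz : ~ (rr u == rr z) && (cc u == cc z).
      by move=> /andP[/eqP e1 /eqP e2]; case/eqP: uz; apply: coord_inj.
    rewrite (_ : (rr z < rr u) || _ = ((rr z < rr u) || (rr z == rr u) && ((cc z).-1 - j < cc u - j))) //.
    by lia.
  + by exists t.+1, S', z'; rewrite iterSr step.
(* At the exit column it moves up, unless row [i] is reached. *)
have {le_b} eb : beta (rr z) = cc z - j by lia.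
have [ei|ne] := eqVneq (rr z) i.
  exists 0, S, z; rewrite -ei eb subnKC //.
have [|w [rw cw]] := @coord_ex (rr z).-1 (cc z).
  by apply: leq_trans (coord_lt z) (L_mono _); lia.
have wz : w != z by apply/eqP => e; subst w; lia.
have up : goes_up V (rr z) (cc z - j) by rewrite -eb bE exit_col_up.
have step : undrop_step U k (S, z) = (exchange S w z, w).
  apply/undrop_stepE/max_predE; first by rewrite nplusE; lia.
    by rewrite le_U; lia.
  move=> v zv kv; have [->//|vw] := eqVneq v w; move: kv; rewrite le_U => kv.
  move: zv; rewrite nplusE => /orP[/andP[/eqP rv /eqP cv]|/andP[/eqP rv /eqP cv]].
    by case/eqP: vw; apply: coord_inj; lia.
  have vz : v != z by apply/eqP => e; subst v; lia.
  rewrite !Sold //; try lia.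
  move: up; rewrite /goes_up => /orP[|/andP[_]]; first by lia.
  by rewrite rw cw -rv (_ : (cc z - j).-1 = cc v - j); [apply: ltnW | lia].
have := IHm w (exchange S w z); case=> [|||||t [S' [z' [it rz' cz' S'E]]]]; try lia.
- have := @path_col_mono V a b0 (rr z).-1.
  by rewrite rw cw -eb prednK; lia.
- move=> u uw ju; have [->|uz] := eqVneq u z.
    rewrite exchangeR Sold // ?rw ?cw; try lia.
    rewrite /shifted /on_path ifT; last by lia.
    by rewrite ifT; [congr (V _ _)|]; lia.
  rewrite exchangeD // Sz // /shifted rw cw.
  have /negP nuz : ~ (rr u == rr z) && (cc u == cc z).
    by move=> /andP[/eqP e1 /eqP e2]; case/eqP: uz; apply: coord_inj.
  congr (if _ then _ else _); rewrite /on_path.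
  have [eu|neu] := eqVneq (rr u) (rr z); first by rewrite eu eb; lia.
  have [eu|neu'] := eqVneq (rr u) (rr z).-1; last by lia.
  by rewrite eu (_ : (rr z).-1.+1 = rr z) ?eb; lia.
- by exists t.+1, S', z'; rewrite iterSr step.
Qed.

Lemma undrop_reach :
  exists t S' z', [/\ iter t (undrop_step U k) (T, y) = (S', z'),
    rr z' = i, cc z' = j + beta i &
    forall w, w != z' -> j <= cc w -> S' w = shifted i (beta i) (rr w) (cc w - j) :> nat].
Proof.
apply: (@undrop_track _ y T (leqnn _)) => //; first by rewrite le_iy /=.
  by have := @path_col_mono V a b0 a (leqnn a); rewrite path_col_last leqnn andbT.
move=> w wy jw; rewrite /shifted ifF; first by rewrite (@val_atE _ _ _ _ w) // subnKC.
apply/negbTE; rewrite negb_and; have [ew|new] := eqVneq (rr w) a.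
  by rewrite /on_path ew path_col_last; lia.
by rewrite /on_path; lia.
Qed.

Lemma undrop_shift : beta i = 0 ->
  (undrop U k T y).2 = x /\
  forall h c, i <= h -> c < len h -> (h, c) != (i, 0) ->
    val_at j (undrop U k T y).1 h c = shifted i 0 h c.
Proof.
move=> b_i; have [t [S' [z' [it rz cz S'E]]]] := undrop_reach.
have ezx : z' = x by apply: coord_inj; rewrite // cz b_i addn0.
subst z'; have ky : U x <= U y by rewrite le_U; lia.
have [_ fx _] := undropP ky sT.
have E : undrop U k T y = (S', x).
  rewrite -it; case: (leqP t (depth lam)) => le_t.
    by apply: iter_fixed le_t; rewrite it undrop_step_start.
  by symmetry; apply: iter_fixed (ltnW le_t).
rewrite E; split=> // h c le_ih lt_c nx.
have [|z [rz' cz']] := @coord_ex h (j + c); first by lia.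
rewrite (val_atE _ rz' cz') S'E ?b_i ?rz' ?cz' ?addKn ?leq_addr //.
by apply: contraNN nx => /eqP ezx; rewrite xpair_eqE -rz' ezx eqxx /=; move: cz'; rewrite ezx; lia.
Qed.

(** From [(i, j + beta i)] the slide can still go up: the cells right of column [j] have all been
    processed. It then lies above row [i] and never descends to [x]. *)
Lemma undrop_miss : beta i != 0 -> (undrop U k T y).2 != x.
Proof.
move=> b_i; have [t [S' [z' [it rz cz S'E]]]] := undrop_reach.
have ky : U x <= U y by rewrite le_U; lia.
have [_ fx _] := undropP ky sT; apply/eqP => ux.
have bE : beta i = exit_col V i (beta i.+1) by apply: path_colE.
have := exit_col_up V i (beta i.+1); rewrite -bE /goes_up (negPf b_i) /= => /andP[i_gt0 up].
have [|w [rw cw]] := @coord_ex i.-1 (cc z').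
  by apply: leq_trans (coord_lt z') (L_mono _); lia.
have zw : z' \in nplus w by rewrite nplusE; lia.
have step : undrop_step U k (S', z') = (exchange S' w z', w).
  apply/undrop_stepE/max_predE => //; first by rewrite le_U; lia.
  move=> v zv kv; have [->//|vw] := eqVneq v w; move: kv; rewrite le_U => kv.
  move: zv; rewrite nplusE => /orP[/andP[/eqP rv /eqP cv]|/andP[/eqP rv /eqP cv]].
    by case/eqP: vw; apply: coord_inj; lia.
  have vz : v != z' by apply/eqP => e; subst v; lia.
  have wz : w != z' by apply/eqP => e; subst w; lia.
  rewrite !S'E //; try lia.
  rewrite /shifted /on_path rw cw cz -rv rz !ifF; try lia.
  by rewrite addKn (_ : cc v - j = (beta i).-1); [apply: ltnW | move: b_i; lia].
(* The slide is stationary after [depth] steps, so prolonging it by [t.+1] steps does not change its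
   end. *)
have := @iter_fixed _ (undrop_step U k) (T, y) (depth lam) (depth lam + t.+1) fx (leq_addr _ _).
rewrite -/(undrop U k T y) iterD iterS it step => e.
have := undrop_row_iter_le (U x) (depth lam) (exchange S' w z', w).
by rewrite e ux /= rw; lia.
Qed.

End Undrop.

Lemma tail_weight_undrop y : i <= rr y -> j <= cc y -> path_col V (rr y) (cc y - j) i = 0 ->
  tail_weight j i (undrop U k T y).1 =
  entry_weight (exit_col V) len (M j) i (rr y) (cc y - j).
Proof.
move=> le_iy le_jy b_i; have [_ shiftE] := undrop_shift le_iy le_jy b_i.
have b_last := path_col_last V (rr y) (cc y - j).
have le_b h : h <= rr y -> path_col V (rr y) (cc y - j) h.+1 <= cc y - j.
  by move=> _; apply: entry_le => *; apply: exit_col_le.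
have lt_len h : h <= rr y -> cc y - j < len h.
  by move=> /len_mono; have := coord_lt y; lia.
apply: prod_below_path => //; [exact: len_mono|exact: val_at_row|exact: val_at_col| | | | | ].
- move=> h c le_h lt_c off; rewrite shiftE // /shifted ?(negPf off) //.
  by apply: contraNN off => /eqP[-> ->]; rewrite /on_path b_i leqnn le_iy.
- move=> h c ih cb; have le_h : h <= rr y by lia.
  have := le_b h le_h; have := lt_len h le_h => lt_l le_b1.
  rewrite shiftE; [|lia|lia|by rewrite xpair_eqE; lia].
  by rewrite /shifted /on_path ifT ?ifF //; lia.
- move=> h ih; have le_h : h <= rr y by lia.
  have := @path_col_mono V (rr y) (cc y - j) h le_h.
  have := le_b h le_h; have := lt_len h le_h => lt_l le_b1 le_b2.
  rewrite shiftE; [|lia|lia|by rewrite xpair_eqE; lia].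
  by rewrite /shifted /on_path ifT ?eqxx //; lia.
- by rewrite ML; have := coord_lt y; lia.
- exact: lt_len.
Qed.

(** A slide ends in [x] iff it leaves row [i] in relative column 0. Then [tail_weight_undrop]
    expresses the summand through [T] alone, and [sum_entry_weight] applies with [t = 1]. *)
Lemma sum_tail_weight :
  \sum_(y | (U x <= U y) && ((undrop U k T y).2 == x)) tail_weight j i (undrop U k T y).1 =
  col_weight j i T.
Proof.
rewrite /col_weight -(sum_entry_weight (len := len)) ?ML ?coord_lt //; first last.
- exact: len_mono.
- by move=> *; apply: exit_col_mono.
- by move=> *; apply: exit_col_le.
rewrite -(sum_cells i j (fun a c => (entry (exit_col V) (a - i).+1 a c < 1) *
  entry_weight (exit_col V) len (M j) i a c)).
rewrite big_mkcond [RHS]big_mkcond; apply: eq_bigr => y _.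
(* Backward slides never move down, so none from above row [i] ends in [x]. *)
have [le_iy|lt_yi] := leqP i (rr y); last first.
  case: ifP => // /andP[_ /eqP ux].
  have := undrop_row_iter_le (U x) (depth lam) (T, y); rewrite -/(undrop U k T y) ux /=.
  by lia.
case: (leqP j (cc y)) => le_jy /=; last by rewrite le_U; case: ifP => // /andP[]; lia.
have -> : U x <= U y by rewrite le_U; lia.
have be : entry (exit_col V) (rr y - i) (rr y).-1 (exit_col V (rr y) (cc y - j)) =
    path_col V (rr y) (cc y - j) i.
  by rewrite /path_col subSn.
rewrite be ltnS leqn0; have [b_i|b_i] := eqVneq (path_col V (rr y) (cc y - j) i) 0.
  by have [-> _] := undrop_shift le_iy le_jy b_i; rewrite eqxx mul1n tail_weight_undrop.
by rewrite (negPf (undrop_miss le_iy le_jy b_i)) mul0n.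
Qed.

End Round.

Definition after_card k T := #|[set S | after U k S == T]|.

Lemma after_card_step x K T :
  (forall S, sorted_from U (U x).+1 S ->
     after_card (U x).+1 S = K * tail_weight (cc x) (rr x) S) ->
  sorted_from U (U x) T -> after_card (U x) T = K * col_weight (cc x) (rr x) T.
Proof.
move=> IH sT; rewrite -sum_tail_weight // big_distrr /=.
rewrite -(sum_drop_fibre (fun S => K * tail_weight (cc x) (rr x) S) (erefl _) sT).
rewrite -(eq_bigr _ (F1 := fun S => after_card (U x).+1 S)) => [|S /andP[sS _]]; last exact: IH.
rewrite /after_card -sum1_card (partition_big (after U (U x).+1)
  (fun S => sorted_from U (U x).+1 S && ((drop_entry x S).1 == T))) => [|S] /=.
  apply: eq_bigr => S /andP[_ /eqP dS]; rewrite -sum1_card; apply: eq_bigl => R.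
  rewrite !inE (after_step _ (erefl (nat_of_ord (U x)))).
  by case: (eqVneq (after U (U x).+1 R) S) => [->|]; rewrite ?dS ?eqxx ?andbF.
by rewrite inE (after_step _ (erefl (nat_of_ord (U x)))) after_sorted.
Qed.

(** In row 0 every slide runs left to column 0, so all cells are counted and [T] no longer
    matters. *)
Lemma col_weight_top j T :
  col_weight j 0 T = \prod_(0 <= h < M j) (M j - h.+1 + (L h - j)).
Proof.
apply: eq_bigr => h _; congr (_ + _).
rewrite (eq_bigr (fun=> 1)) ?sum1_card ?card_ord // => c _.
by rewrite subn0 entryS subnn exit_col0.
Qed.

Lemma cell_above x : 0 < rr x -> exists z,
  [/\ rr x = (rr z).+1, cc z = cc x & U x = (U z).+1 :> nat].
Proof.
move=> rx_gt0; have [|z [rz cz]] := @coord_ex (rr x).-1 (cc x).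
  by apply: leq_trans (coord_lt x) (L_mono _); lia.
have rx : rr x = (rr z).+1 by lia.
by exists z; split=> //; apply: colU.
Qed.

Definition round_weight k T : nat :=
  if cell_of U k is Some x then col_weight (cc x) (rr x) T else 1.

Lemma after_card_weight k : k <= n ->
  exists K, forall T, sorted_from U k T -> after_card k T = K * round_weight k T.
Proof.
have none m : n <= m -> cell_of U m = None.
  by move=> le_m; rewrite /cell_of; case: pickP => // x /eqP Ux; have := ltn_ord (U x); lia.
move: k; apply: (@round_ind _ _ U) => [|x [K IH]].
  exists 1 => T _; rewrite /round_weight none // /after_card.
  by rewrite (_ : [set S | _] = [set T]) ?cards1 //; apply/setP => S; rewrite !inE after_n.
suff [K' K'P] : exists K', forall S, K * round_weight (U x).+1 S = K' * tail_weight (cc x) (rr x) S.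
  exists K' => T sT; rewrite /round_weight (cell_ofE (erefl (nat_of_ord (U x)))).
  by apply: after_card_step => // S sS; rewrite IH // K'P.
have [lt_x|le_x] := ltnP (rr x).+1 (M (cc x)).
  (* The previous round was that of the cell below [x], whose column weight is the tail weight of
     [x]. *)
  have [|y [ry cy]] := @coord_ex (rr x).+1 (cc x); first by rewrite -ML.
  exists K => S; congr (_ * _).
  rewrite /round_weight (cell_ofE (colU ry cy)) cy ry; apply: eq_big_nat => h /andP[lt_h _].
  congr (_ + _); apply: eq_bigr => c _.
  by rewrite ltnS leqn0 (_ : (h - (rr x).+1).+1 = h - rr x) //; lia.
(* At the bottom of a column, the previous round either was at the top of the next column or did not
   exist; its weight is constant in both cases. *)
have tail1 S : tail_weight (cc x) (rr x) S = 1 by apply: big_geq.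
suff [K' K'P] : exists K', forall S, round_weight (U x).+1 S = K'.
  by exists (K * K') => S; rewrite K'P tail1 muln1.
rewrite /round_weight; case E: cell_of => [y|]; last by exists 1.
have Uy : U y = (U x).+1 :> nat by move: E; rewrite /cell_of; case: pickP => // z /eqP + [<-].
(* Otherwise the cell above [y] would be [x], the last one of its column. *)
have ry : rr y = 0.
  case: (posnP (rr y)) => // /cell_above[z [rz cz Uz]].
  have ezx : z = x by apply/eqP; rewrite -(tableau_eq U); lia.
  have := coord_lt y; rewrite -ML -cz ezx; rewrite -ezx in le_x *; lia.
by eexists => S; rewrite ry col_weight_top.
Qed.

Lemma column_distribution_const : exists K, forall W, distribution U W = K.
Proof.
have [K KP] := after_card_weight (leq0n n).
suff [K' K'P] : exists K', forall T, round_weight 0 T = K'.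
  exists (K * K') => W; rewrite ffunE -(K'P W) -KP; last by rewrite sorted_from0 syt_standard.
  rewrite /after_card; apply: eq_card => T; rewrite !inE.
  by have [-> _] := nps_after U T.
rewrite /round_weight; case E: cell_of => [x|]; last by exists 1.
have rx : rr x = 0.
  case: (posnP (rr x)) => // /cell_above[z [_ _ Uz]].
  by move: E Uz; rewrite /cell_of; case: pickP => // y /eqP + [<-] => ->.
by eexists => T; rewrite rx col_weight_top.
Qed.

End ColumnOrder.

(** Both vectors sum to the number of tableaux over the same nonempty index set. *)
Lemma constant_distribution_eq (n : nat) (lam : integer_partition n) (U V : syt lam) K K' :
  (forall W, distribution U W = K) -> (forall W, distribution V W = K') ->
  distribution U = distribution V.
Proof.
move=> UK VK; have total (X : syt lam) : \sum_W distribution X W = #|{: tableau lam}|.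
  rewrite -sum1_card (partition_big (fun T => Syt (standard_nps_result X T)) xpredT) //=.
  apply: eq_bigr => W _; rewrite ffunE -sum1_card; apply: eq_bigl => T.
  by rewrite inE -val_eqE.
apply/ffunP => W; rewrite UK VK; have := total U; rewrite -(total V).
rewrite (eq_bigr _ (fun W _ => UK W)) (eq_bigr _ (fun W _ => VK W)) !sum_nat_const.
by move/eqP; rewrite eqn_pmul2l => [/eqP //|]; apply/card_gt0P; exists U.
Qed.

(** * The two linear orders as instances, one transposed *)

Section Coordinates.

Variables (n : nat) (lam : integer_partition n).

Definition row_length (h : nat) : nat := nth 0 lam h.
(** The conjugate partition: as the parts decrease, the first index with a part at most [c] counts
    the parts exceeding [c]. *)
Definition col_length (c : nat) : nat := find (fun p => p <= c) lam.

Lemma col_lengthE h c : (h < col_length c) = (c < row_length h).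
Proof.
rewrite /col_length /row_length; apply/idP/idP => [lt_h|].
  by rewrite ltnNge (before_find 0 lt_h).
move=> lt_c; rewrite ltnNge; apply/negP => le_h; move: lt_c; apply/negP; rewrite -leqNgt.
apply: leq_trans (nth_lam_leq lam le_h) _.
case: (boolP (has (fun p => p <= c) lam)) => [|nh]; first exact: nth_find.
by rewrite nth_default // leqNgt -has_find.
Qed.

Lemma nplus_coord (x y : cell lam) : (y \in nplus x) =
  (row_of y == (row_of x).+1) && (col_of y == col_of x) ||
  (row_of y == row_of x) && (col_of y == (col_of x).+1).
Proof. by rewrite inE. Qed.

Lemma column_wise_const (U : syt lam) : column_wise U -> exists K, forall W, distribution U W = K.
Proof.
move=> colU; apply: (@column_distribution_const _ _ U (@row_of _ lam) (@col_of _ lam) row_length col_length).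
- exact: nplus_coord.
- exact: cell_eq.
- exact: cell_lt.
- exact: cell_ex.
- exact: col_lengthE.
- by move=> x y rxy cxy; apply: colU; rewrite /below rxy cxy !eqxx.
Qed.

Lemma row_wise_const (U : syt lam) : row_wise U -> exists K, forall W, distribution U W = K.
Proof.
move=> rowU; apply: (@column_distribution_const _ _ U (@col_of _ lam) (@row_of _ lam) col_length row_length).
- by move=> x y; rewrite nplus_coord orbC; congr (_ || _); apply: andbC.
- by move=> x y exy /cell_eq ->.
- by move=> x; rewrite col_lengthE cell_lt.
- by move=> h c; rewrite col_lengthE => /cell_ex[x [? ?]]; exists x.
- by move=> h c; rewrite col_lengthE.
- by move=> x y cxy rxy; apply: rowU; rewrite /right_of rxy cxy !eqxx.
Qed.

End Coordinates.

Theorem corollary4p5 (n : nat) (lam : integer_partition n) :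
  (forall U V : syt lam, distribution U = distribution V ->
     complexity U = complexity V) /\
  (forall U V : syt lam, column_wise U -> row_wise V ->
     complexity U = complexity V).
Proof.
split=> U V; first exact: eq_distribution_complexity.
move=> /column_wise_const[K UK] /row_wise_const[K' VK].
exact/eq_distribution_complexity/(constant_distribution_eq UK VK).
Qed.
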